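(* Let $\Gamma$ be an $\tilde A_2$ group acting on a building $\mathcal B$ of type $\tilde A_2$ and order $q$, let $\Omega$ be the boundary of $\mathcal B$, and let $\mathcal A(\Gamma)=C(\Omega)\rtimes\Gamma$. Let $[\mathbf 1]\in K_0(\mathcal A(\Gamma))$ be the class of the identity element $\mathbf 1$ of $\mathcal A(\Gamma)$. Then in the group $K_0(\mathcal A(\Gamma))$ we have $(q^2-1)[\mathbf 1]=0$.
   Context: A building $\mathcal B$ of type $\tilde A_2$ is a thick building whose apartments are Coxeter complexes of type $\tilde A_2$, i.e. tilings of the Euclidean plane by equilateral triangles (chambers); it is assumed locally finite, and has order $q$ if each edge lies on exactly $q+1$ chambers. There is a type map $\tau$ from vertices to $\mathbb Z/3\mathbb Z$ such that each chamber has exactly one vertex of each type; an automorphism $\alpha$ is type rotating if $\tau(\alpha(v))=\tau(v)+i$ for some fixed $i$ and all vertices $v$. An $\tilde A_2$ group is a group of automorphisms of $\mathcal B$ which acts freely and transitively on the vertex set in a type rotating manner. A sector is a $\frac{\pi}{3}$-angled sector made up of chambers in some apartment; two sectors are equivalent if their intersection contains a sector; $\Omega$ is the set of equivalence classes. Fix a vertex $O$. For each $\omega\in\Omega$ there is a unique sector $[O,\omega)$ in the class $\omega$ with base vertex $O$, and $\Omega$ is compact Hausdorff and totally disconnected with base of open sets $\{\omega: v\in[O,\omega)\}$, $v$ a vertex. $\Gamma$ acts on $\Omega$, and $C(\Omega)\rtimes\Gamma$ is the crossed product $C^*$-algebra. *)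

(* Defs.v *)
From HB Require Import structures.
From mathcomp Require Import all_boot all_order all_algebra.
From mathcomp Require Import complex generic_quotient.
From mathcomp Require Import all_classical all_reals all_analysis.

Set Implicit Arguments.
Unset Strict Implicit.
Unset Printing Implicit Defensive.

Import Order.TTheory GRing.Theory Num.Theory.
Import numFieldNormedType.Exports.

Local Open Scope classical_set_scope.
Local Open Scope card_scope.
Local Open Scope ring_scope.

(* Simplices are nonempty sets of vertices. *)
Record simplicial_complex := SimplicialComplex {
  vertex :> Type;
  simplex : set (set vertex);
  simplex_finite : forall s, simplex s -> finite_set s;
  simplex_nonempty : forall s, simplex s -> s !=set0;
  simplex_face : forall s t, simplex s -> t `<=` s -> t !=set0 -> simplex t;
  simplex_vertex : forall v : vertex, simplex [set v] }.

Section Complex.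
Variable X : simplicial_complex.
Implicit Types (s t c e : set X).

Definition chamber c :=
  simplex c /\ forall s, simplex s -> c `<=` s -> s = c.

Definition edge e := simplex e /\ e #= `I_2.

Definition edge_chambers e := [set c | chamber c /\ e `<=` c].

Definition thick := forall e, edge e -> `I_3 #<= edge_chambers e.

Definition has_order (q : nat) :=
  forall e, edge e -> edge_chambers e #= `I_q.+1.

End Complex.

(* The tiling of the plane by equilateral triangles: (i, j) stands for the
   point i e1 + j e2, where e1 and e2 are unit vectors at angle pi / 3. *)
Definition up_triangle (i j : int) : set (int * int) :=
  [set (i, j); (i + 1, j); (i, j + 1)].
Definition down_triangle (i j : int) : set (int * int) :=
  [set (i + 1, j); (i, j + 1); (i + 1, j + 1)].
Definition plane_chamber : set (set (int * int)) :=
  [set c | exists i j, c = up_triangle i j \/ c = down_triangle i j].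
Definition plane_simplex : set (set (int * int)) :=
  [set s | s !=set0 /\ exists2 c, plane_chamber c & s `<=` c].

(* The chambers of the cone spanned by e1 and e2. *)
Definition plane_sector : set (set (int * int)) :=
  [set c | plane_chamber c /\ forall p, c p -> 0 <= p.1 /\ 0 <= p.2].

Section Apartments.
Variable X : simplicial_complex.
(* A subcomplex is given by its set of simplices. *)
Implicit Types (S : set (set X)).

Definition chart S (phi : int * int -> X) :=
  injective phi /\ [set phi @` s | s in plane_simplex] = S.

Definition subcomplex_iso S S' (psi : X -> X) :=
  {in \bigcup_(s in S) s &, injective psi} /\ [set psi @` s | s in S] = S'.

Record apartment_system (AA : set (set (set X))) : Prop := ApartmentSystem {
  apartment_sub : forall S, AA S -> S `<=` @simplex X;
  apartment_chart : forall S, AA S -> exists phi, chart S phi;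
  apartment_join : forall s t, simplex s -> simplex t ->
    exists S, [/\ AA S, S s & S t];
  apartment_iso : forall S S' s t, AA S -> AA S' ->
    S s -> S t -> S' s -> S' t ->
    exists2 psi, subcomplex_iso S S' psi &
      forall x, (s `|` t) x -> psi x = x }.

End Apartments.

(* The apartments are those of the complete (that is, the largest) apartment
   system, as is needed for the boundary to be compact. *)
Record A2_building := A2Building {
  building_complex :> simplicial_complex;
  apartment : set (set (set building_complex));
  apartmentP : apartment_system apartment;
  apartment_complete :
    forall AA, apartment_system AA -> AA `<=` apartment;
  building_thick : thick building_complex }.

Definition type_map (B : A2_building) (tau : B -> 'Z_3) :=
  forall c : set B, chamber c -> forall i, exists! v, c v /\ tau v = i.

Record automorphism (B : A2_building) := Automorphism {
  aut_fun :> B -> B;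
  aut_bij : bijective aut_fun;
  aut_simplex : forall s : set B, simplex (aut_fun @` s) <-> simplex s }.

Definition type_rotating (B : A2_building) (tau : B -> 'Z_3)
    (a : automorphism B) :=
  exists i, forall v, tau (a v) = tau v + i.

(* As the action is free, G is identified with a group of automorphisms. *)
Record A2_group (B : A2_building) (tau : B -> 'Z_3) (G : groupType)
    (act : G -> automorphism B) : Prop := A2Group {
  act_one : forall v, act 1%g v = v;
  act_mul : forall g h v, act (g * h)%g v = act g (act h v);
  act_free : forall g v, act g v = v -> g = 1%g;
  act_transitive : forall v w, exists g, act g v = w;
  act_rotating : forall g, type_rotating tau (act g) }.

Section Sectors.
Variable B : A2_building.
(* A sector is given by its set of chambers. *)
Implicit Types (S T : set (set B)) (E : set (set (set B))).

Definition sector_at (v : B) S :=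
  exists A phi, [/\ apartment A, chart A phi, phi (0, 0) = v &
    S = [set phi @` c | c in plane_sector]].

Definition sector S := exists v, sector_at v S.

Definition sector_equiv S S' := exists2 T, sector T & T `<=` S `&` S'.

Definition sector_class S := [set S' | sector S' /\ sector_equiv S S'].

Definition is_sector_class E := exists2 S, sector S & E = sector_class S.

(* The vertex O only serves to define the topology. *)
Definition boundary (O : B) := {E | is_sector_class E}.

HB.instance Definition _ (O : B) := gen_eqMixin (boundary O).
HB.instance Definition _ (O : B) := gen_choiceMixin (boundary O).

(* The set of w such that v is a vertex of the sector [O, w). *)
Definition boundary_basic (O v : B) : set (boundary O) :=
  [set w | exists S, [/\ sval w S, sector_at O S & (\bigcup_(c in S) c) v]].

(* These sets form a base, so the topology that they generate as a subbase is
   the one having them as a base. *)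
HB.instance Definition _ (O : B) := @isSubBaseTopological.Build (boundary O)
  (set (boundary O)) (range (@boundary_basic O)) id.

End Sectors.

Section BoundaryAction.
Variable B : A2_building.
Implicit Types (a b : automorphism B).

Definition aut_chambers a (S : set (set B)) := [set a @` c | c in S].

Lemma cancel_image (T U : Type) (f : T -> U) (g : U -> T) :
  cancel f g -> cancel (image^~ f) (image^~ g).
Proof.
move=> fK s; apply/seteqP; split=> [_ [_ [x sx <-] <-]|x sx].
  by rewrite fK.
by exists (f x) => //; exists x.
Qed.

Lemma aut_inverse a : exists b, cancel a b /\ cancel b a.
Proof.
have [b ab ba] := aut_bij a.
have bS (s : set B) : simplex (b @` s) <-> simplex s.
  by rewrite -{2}(cancel_image ba s); split=> /aut_simplex.
by exists (@Automorphism B b (Bijective ba ab) bS).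
Qed.

Lemma aut_chambersK a b : cancel a b ->
  cancel (aut_chambers a) (aut_chambers b).
Proof. by move=> ab; exact/cancel_image/cancel_image. Qed.

Lemma aut_chart a S phi : chart S phi -> chart (aut_chambers a S) (a \o phi).
Proof.
move=> [phi_inj <-]; split; first exact/inj_comp/phi_inj/bij_inj/aut_bij.
rewrite /aut_chambers image_comp; apply: eq_imagel => s _ /=.
by rewrite image_comp.
Qed.

Lemma aut_apartment a S : apartment S -> apartment (aut_chambers a S).
Proof.
move=> AS.
have [b [ab ba]] := aut_inverse a.
have baK (s : set B) : a @` (b @` s) = s := cancel_image ba s.
have abK (s : set B) : b @` (a @` s) = s := cancel_image ab s.
pose AA := [set aut_chambers a S | S in @apartment B].
suff : apartment_system AA by move/apartment_complete; apply; exists S.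
have memE (S' : set (set B)) s : aut_chambers a S' s -> S' (b @` s).
  by case=> s' S's' <-; rewrite abK.
split.
- move=> _ [S' AS' <-] _ [s S's <-]; apply/aut_simplex.
  exact: apartment_sub (apartmentP B) _ AS' _ S's.
- move=> _ [S' AS' <-]; have [phi] := apartment_chart (apartmentP B) AS'.
  by move/(aut_chart a) => ?; exists (a \o phi).
- move=> s t sS tS.
  have [||S' [AS' S's S't]] := @apartment_join _ _ (apartmentP B)
    (b @` s) (b @` t); [exact/aut_simplex | exact/aut_simplex |].
  exists (aut_chambers a S'); split; first by exists S'.
  + by exists (b @` s).
  + by exists (b @` t).
- move=> _ _ s t [S1 AS1 <-] [S2 AS2 <-] /memE S1s /memE S1t /memE S2s /memE S2t.
  have [psi [psi_inj psiE] fix_psi] :=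
    apartment_iso (apartmentP B) AS1 AS2 S1s S1t S2s S2t.
  exists (a \o psi \o b).
    split.
      move=> x y; rewrite !inE => -[s1 /memE S1s1 s1x] [s2 /memE S1s2 s2y] /=.
      move/(bij_inj (aut_bij a))/psi_inj => xy.
      apply: (can_inj ba); apply: xy; rewrite inE.
      + by exists (b @` s1) => //; exists x.
      + by exists (b @` s2) => //; exists y.
    rewrite -psiE /aut_chambers !image_comp; apply: eq_imagel => u _.
    by rewrite /= !image_comp; apply: eq_imagel => x _; rewrite /= ab.
  move=> x stx /=; rewrite fix_psi ?ba//.
  by case: stx => [sx|tx]; [left; exists x | right; exists x].
Qed.

Lemma aut_sector_at a v S : sector_at v S -> sector_at (a v) (aut_chambers a S).
Proof.
move=> [A [phi [AA phiP phi0 ->]]]; exists (aut_chambers a A), (a \o phi).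
split; [exact: aut_apartment|exact: aut_chart|by rewrite /= phi0|].
rewrite /aut_chambers image_comp; apply: eq_imagel => s _ /=.
by rewrite image_comp.
Qed.

Lemma aut_sector a S : sector S -> sector (aut_chambers a S).
Proof. by move=> [v vS]; exists (a v); exact: aut_sector_at. Qed.

Lemma aut_sector_equiv a S T :
  sector_equiv S T -> sector_equiv (aut_chambers a S) (aut_chambers a T).
Proof.
move=> [U sU UST]; exists (aut_chambers a U); first exact: aut_sector.
by move=> _ [c /UST[Sc Tc] <-]; split; exists c.
Qed.

Lemma aut_sector_class a E :
  is_sector_class E -> is_sector_class [set aut_chambers a S | S in E].
Proof.
move=> [S sS ->]; exists (aut_chambers a S); first exact: aut_sector.
have [b [ab ba]] := aut_inverse a.
apply/seteqP; split=> [_ [T [sT ST] <-]|T [sT ST]].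
  by split; [exact: aut_sector|exact: aut_sector_equiv].
exists (aut_chambers b T); last exact: aut_chambersK.
split; first exact: aut_sector.
by have := aut_sector_equiv b ST; rewrite (aut_chambersK ab).
Qed.

Definition boundary_map (O : B) a (w : boundary O) : boundary O :=
  exist _ _ (aut_sector_class a (svalP w)).

End BoundaryAction.

(* The norm takes its (nonnegative real) values in C, as everywhere in the
   library. It is not the norm of a normedModType, as the hierarchy has no
   common substructure for the latter and for rings. *)
HB.mixin Record isCStar (C : numClosedFieldType) A of GRing.Algebra C A := {
  star : A -> A;
  cnorm : A -> C;
  starK : involutive star;
  starD : {morph star : a b / a + b};
  starZ : forall (c : C) a, star (c *: a) = c^* *: star a;
  starM : forall a b, star (a * b) = star b * star a;
  cnorm_ge0 : forall a, 0 <= cnorm a;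
  cnorm_eq0 : forall a, cnorm a = 0 -> a = 0;
  cnormD : forall a b, cnorm (a + b) <= cnorm a + cnorm b;
  cnormZ : forall (c : C) a, cnorm (c *: a) = `|c| * cnorm a;
  cnormM : forall a b, cnorm (a * b) <= cnorm a * cnorm b;
  cnorm_starM : forall a, cnorm (star a * a) = cnorm a ^+ 2;
  cnorm_complete : forall s : nat -> A,
    (forall e : C, 0 < e -> exists N, forall m n, (N <= m)%N -> (N <= n)%N ->
      cnorm (s m - s n) < e) ->
    exists l, forall e : C, 0 < e -> exists N, forall n, (N <= n)%N ->
      cnorm (s n - l) < e }.

(* Unital C*-algebras; as for every algType, 1 is different from 0. *)
#[short(type="cstarAlgType")]
HB.structure Definition CStarAlgebra (C : numClosedFieldType) :=
  { A of GRing.Algebra C A & isCStar C A }.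

Section ContinuousFunctions.
Variables (X : topologicalType) (C : numClosedFieldType).
Local Notation CX := (continuousType X C).
Implicit Types f g h : CX.

Definition cfun_of (f : X -> C) (fc : continuous f) : CX :=
  mkcts fc.

Let cst_cont (c : C) : continuous (fun _ : X => c).
Proof. by move=> x; exact: cvg_cst. Qed.
Let add_cont f g : continuous (fun x => f x + g x).
Proof. by move=> x; apply: cvgD; exact: cts_fun. Qed.
Let opp_cont f : continuous (fun x => - f x).
Proof. by move=> x; apply: cvgN; exact: cts_fun. Qed.
Let mul_cont f g : continuous (fun x => f x * g x).
Proof. by move=> x; apply: cvgM; exact: cts_fun. Qed.
Let conj_cont f : continuous (fun x => (f x)^*).
Proof.
move=> x; apply/cvgrPdist_lt => e e0.
have /cvgrPdist_lt/(_ e e0) := @cts_fun _ _ f x.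
by apply: filterS => y; rewrite -rmorphB norm_conjC.
Qed.

Definition cfun_cst (c : C) : CX := cfun_of (@cst_cont c).
Definition cfun_add f g : CX := cfun_of (@add_cont f g).
Definition cfun_opp f : CX := cfun_of (@opp_cont f).
Definition cfun_mul f g : CX := cfun_of (@mul_cont f g).
Definition cfun_conj f : CX := cfun_of (@conj_cont f).

Let addA : associative cfun_add.
Proof. by move=> f g h; apply/continuousEP => x; exact: addrA. Qed.
Let addC : commutative cfun_add.
Proof. by move=> f g; apply/continuousEP => x; exact: addrC. Qed.
Let add0 : left_id (cfun_cst 0) cfun_add.
Proof. by move=> f; apply/continuousEP => x; exact: add0r. Qed.
Let addN : left_inverse (cfun_cst 0) cfun_opp cfun_add.
Proof. by move=> f; apply/continuousEP => x; exact: addNr. Qed.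

HB.instance Definition _ := GRing.isZmodule.Build CX addA addC add0 addN.

Let mulA : associative cfun_mul.
Proof. by move=> f g h; apply/continuousEP => x; exact: mulrA. Qed.
Let mulC : commutative cfun_mul.
Proof. by move=> f g; apply/continuousEP => x; exact: mulrC. Qed.
Let mul1 : left_id (cfun_cst 1) cfun_mul.
Proof. by move=> f; apply/continuousEP => x; exact: mul1r. Qed.
Let mulr1' : right_id (cfun_cst 1) cfun_mul.
Proof. by move=> f; apply/continuousEP => x; exact: mulr1. Qed.
Let mulDl : left_distributive cfun_mul +%R.
Proof. by move=> f g h; apply/continuousEP => x; exact: mulrDl. Qed.
Let mulDr : right_distributive cfun_mul +%R.
Proof. by move=> f g h; apply/continuousEP => x; exact: mulrDr. Qed.

HB.instance Definition _ := @GRing.Zmodule_isPzRing.Build CX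
  (cfun_cst 1) cfun_mul mulA mul1 mulr1' mulDl mulDr.
HB.instance Definition _ := GRing.PzRing_hasCommutativeMul.Build CX mulC.

Definition cfun_scale (c : C) f := cfun_mul (cfun_cst c) f.

Let scaleA a b f : cfun_scale a (cfun_scale b f) = cfun_scale (a * b) f.
Proof. by apply/continuousEP => x; exact: mulrA. Qed.
Let scale1 : left_id 1 cfun_scale.
Proof. by move=> f; apply/continuousEP => x; exact: mul1r. Qed.
Let scaleDr : right_distributive cfun_scale +%R.
Proof. by move=> a f g; apply/continuousEP => x; exact: mulrDr. Qed.
Let scaleDl f : {morph cfun_scale^~ f : a b / a + b}.
Proof. by move=> a b; apply/continuousEP => x; exact: mulrDl. Qed.

HB.instance Definition _ := GRing.Zmodule_isLmodule.Build C CX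
  scaleA scale1 scaleDr scaleDl.

End ContinuousFunctions.

Section CrossedProduct.
Variables (C : numClosedFieldType) (X : topologicalType) (G : groupType).
Variable act : G -> X -> X.

(* In [cov_act], the hypothesis says that f' is f composed with the action of
   the inverse of g. *)
Record covariant_rep (A : cstarAlgType C) (pi : continuousType X C -> A)
    (u : G -> A) : Prop := CovariantRep {
  cov_linear : linear pi;
  cov_morph : monoid_morphism pi;
  cov_star : forall f, pi (cfun_conj f) = star (pi f);
  cov_mul : forall g h, u (g * h)%g = u g * u h;
  cov_unitary : forall g, star (u g) * u g = 1 /\ u g * star (u g) = 1;
  cov_act : forall g (f f' : continuousType X C),
    f' \o act g =1 f -> u g * pi f * star (u g) = pi f' }.

Definition norm_closed (A : cstarAlgType C) (E : set A) :=
  forall a, (forall e : C, 0 < e -> exists2 b, E b & cnorm (a - b) < e) -> E a.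

(* The only norm closed *-subalgebra containing D and 1 is A. *)
Definition cstar_generated (A : cstarAlgType C) (D : set A) :=
  forall E : set A, norm_closed E -> D `<=` E -> E 1 ->
    (forall a b, E a -> E b -> E (a + b)) ->
    (forall a b, E a -> E b -> E (a * b)) ->
    (forall (c : C) a, E a -> E (c *: a)) ->
    (forall a, E a -> E (star a)) ->
    E = setT.

(* The full crossed product of C(X) by G: the universal C*-algebra generated
   by a copy of C(X) and a unitary representation of G that are covariant.
   It is unique up to isomorphism. *)
Record crossed_product := CrossedProduct {
  cp_algebra :> cstarAlgType C;
  cp_fun : continuousType X C -> cp_algebra;
  cp_unitary : G -> cp_algebra;
  cp_covariant : covariant_rep cp_fun cp_unitary;
  cp_generated : cstar_generated (range cp_fun `|` range cp_unitary);
  cp_universal : forall (A : cstarAlgType C) (pi : continuousType X C -> A)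
      (u : G -> A), covariant_rep pi u ->
    exists phi : {lrmorphism cp_algebra -> A},
      [/\ forall a, phi (star a) = star (phi a),
          forall f, phi (cp_fun f) = pi f &
          forall g, phi (cp_unitary g) = u g] }.

End CrossedProduct.

Section Grothendieck.
Variable M : nmodType.
Implicit Types (x y z : M * M).

(* The pair x stands for the formal difference x.1 - x.2. *)
Definition groth_rel x y := `[< exists r, x.1 + y.2 + r = y.1 + x.2 + r >].

Lemma groth_relP x y :
  reflect (exists r, x.1 + y.2 + r = y.1 + x.2 + r) (groth_rel x y).
Proof. exact: asboolP. Qed.

Lemma groth_rel_refl : reflexive groth_rel.
Proof. by move=> x; apply/groth_relP; exists 0. Qed.

Lemma groth_rel_sym : symmetric groth_rel.
Proof.
by move=> x y; apply/groth_relP/groth_relP => -[r rE]; exists r; rewrite rE.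
Qed.

Lemma groth_rel_trans : transitive groth_rel.
Proof.
move=> [y1 y2] [x1 x2] [z1 z2] /groth_relP[r /= rE] /groth_relP[s /= sE].
apply/groth_relP; exists (y2 + r + (y1 + s)) => /=.
rewrite [LHS](AC (2*(2*2)) ((1*3*4)*(5*2*6)))/= rE sE.
by rewrite [LHS](AC (3*3) ((4*2)*((5*3)*(1*6)))).
Qed.

Definition groth_equiv :=
  EquivRel groth_rel groth_rel_refl groth_rel_sym groth_rel_trans.

Definition grothendieck := {eq_quot groth_equiv}%qT.

HB.instance Definition _ := Choice.on grothendieck.
HB.instance Definition _ := EqQuotient.on grothendieck.

Definition groth_pi (x : M * M) : grothendieck := (\pi_grothendieck x)%qT.

Lemma groth_piP x y : groth_pi x = groth_pi y <-> groth_rel x y.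
Proof. by split=> [/eqmodP|?]; last exact/eqmodP. Qed.

Lemma groth_reprK (a : grothendieck) : groth_pi (repr a) = a.
Proof. exact: reprK. Qed.

Definition groth_zero : grothendieck := groth_pi (0, 0).
Definition groth_add (a b : grothendieck) : grothendieck :=
  groth_pi ((repr a).1 + (repr b).1, (repr a).2 + (repr b).2).
Definition groth_opp (a : grothendieck) : grothendieck :=
  groth_pi ((repr a).2, (repr a).1).

Lemma groth_addE x y :
  groth_add (groth_pi x) (groth_pi y) = groth_pi (x.1 + y.1, x.2 + y.2).
Proof.
apply/groth_piP/groth_relP => /=.
have /groth_piP/groth_relP[r rE] := groth_reprK (groth_pi x).
have /groth_piP/groth_relP[s sE] := groth_reprK (groth_pi y).
exists (r + s).
rewrite [LHS](AC (2*2*2) ((1*3*5)*(2*4*6)))/= rE sE.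
by rewrite [LHS](AC (3*3) ((1*4)*(2*5)*(3*6))).
Qed.

Lemma groth_oppE x : groth_opp (groth_pi x) = groth_pi (x.2, x.1).
Proof.
apply/groth_piP/groth_relP => /=.
have /groth_piP/groth_relP[r rE] := groth_reprK (groth_pi x).
by exists r; rewrite [_ + x.1]addrC -rE [x.2 + _]addrC.
Qed.

Lemma groth_addA : associative groth_add.
Proof.
move=> a b c; rewrite -(groth_reprK a) -(groth_reprK b) -(groth_reprK c).
by rewrite !groth_addE /= !addrA.
Qed.

Lemma groth_addC : commutative groth_add.
Proof.
move=> a b; rewrite -(groth_reprK a) -(groth_reprK b) !groth_addE.
by congr (groth_pi (_, _)); exact: addrC.
Qed.

Lemma groth_add0 : left_id groth_zero groth_add.
Proof.
by move=> a; rewrite -(groth_reprK a) groth_addE !add0r -surjective_pairing.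
Qed.

Lemma groth_addN : left_inverse groth_zero groth_opp groth_add.
Proof.
move=> a; rewrite -(groth_reprK a) groth_oppE groth_addE.
apply/groth_piP/groth_relP; exists 0.
by rewrite /= !addr0 add0r addrC.
Qed.

HB.instance Definition _ := GRing.isZmodule.Build grothendieck
  groth_addA groth_addC groth_add0 groth_addN.

Definition groth_class (a : M) : grothendieck := groth_pi (a, 0).

End Grothendieck.

Section Projections.
Variables (C : numClosedFieldType) (A : cstarAlgType C).

Definition adjmx m n (M : 'M[A]_(m, n)) : 'M[A]_(n, m) :=
  (map_mx (@star C A) M)^T.

Lemma star0 : star (0 : A) = 0.
Proof. by rewrite -(scale0r (0 : A)) starZ rmorph0 !scale0r. Qed.

Lemma star_sum I (r : seq I) (F : I -> A) :
  star (\sum_(i <- r) F i) = \sum_(i <- r) star (F i).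
Proof. exact: (big_morph _ (@starD _ A) star0). Qed.

Lemma adjmxK m n (M : 'M[A]_(m, n)) : adjmx (adjmx M) = M.
Proof. by apply/matrixP => i j; rewrite !mxE starK. Qed.

Lemma adjmxM m n p (M : 'M[A]_(m, n)) (N : 'M[A]_(n, p)) :
  adjmx (M *m N) = adjmx N *m adjmx M.
Proof.
apply/matrixP => i j; rewrite !mxE star_sum.
by apply: eq_bigr => k _; rewrite starM !mxE.
Qed.

Lemma adjmx0 m n : adjmx (0 : 'M[A]_(m, n)) = 0.
Proof. by apply/matrixP => i j; rewrite !mxE star0. Qed.

Lemma adjmx_block m1 m2 n1 n2 (a : 'M[A]_(m1, n1)) (b : 'M[A]_(m1, n2))
    (c : 'M[A]_(m2, n1)) (d : 'M[A]_(m2, n2)) :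
  adjmx (block_mx a b c d) =
  block_mx (adjmx a) (adjmx c) (adjmx b) (adjmx d).
Proof.
by rewrite /adjmx map_block_mx tr_block_mx.
Qed.

Lemma adjmx_row m n1 n2 (a : 'M[A]_(m, n1)) (b : 'M[A]_(m, n2)) :
  adjmx (row_mx a b) = col_mx (adjmx a) (adjmx b).
Proof. by rewrite /adjmx map_row_mx tr_row_mx. Qed.

Record projection := Projection {
  proj_dim : nat;
  proj_mx :> 'M[A]_proj_dim;
  proj_adj : adjmx proj_mx = proj_mx;
  proj_idem : proj_mx *m proj_mx = proj_mx }.
Implicit Types p q r : projection.

HB.instance Definition _ := gen_eqMixin projection.
HB.instance Definition _ := gen_choiceMixin projection.

(* Murray-von Neumann equivalence, for projections of possibly different
   sizes. *)
Definition mvn_rel p q :=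
  `[< exists v : 'M[A]_(proj_dim q, proj_dim p),
        adjmx v *m v = p /\ v *m adjmx v = q >].

Lemma mvn_relP p q :
  reflect (exists v : 'M[A]_(proj_dim q, proj_dim p),
             adjmx v *m v = p /\ v *m adjmx v = q) (mvn_rel p q).
Proof. exact: asboolP. Qed.

Lemma mvn_refl : reflexive mvn_rel.
Proof.
by move=> p; apply/mvn_relP; exists (proj_mx p); rewrite proj_adj proj_idem.
Qed.

Lemma mvn_sym : symmetric mvn_rel.
Proof.
suff mvn_imp p q : mvn_rel p q -> mvn_rel q p.
  by move=> p q; apply/idP/idP; exact: mvn_imp.
by case/mvn_relP => v [vp vq]; apply/mvn_relP; exists (adjmx v); rewrite adjmxK.
Qed.

Lemma mvn_trans : transitive mvn_rel.
Proof.
move=> q p r /mvn_relP[v [vp vq]] /mvn_relP[w [wq wr]].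
apply/mvn_relP; exists (w *m v); rewrite adjmxM; split.
  by rewrite mulmxA -(mulmxA (adjmx v)) wq -vq !mulmxA vp -mulmxA vp proj_idem.
by rewrite mulmxA -(mulmxA w) vq -wq !mulmxA wr -mulmxA wr proj_idem.
Qed.

Definition mvn_equiv := EquivRel mvn_rel mvn_refl mvn_sym mvn_trans.

Lemma proj_sum_adj p q :
  adjmx (block_mx p 0 0 q) = block_mx (proj_mx p) 0 0 (proj_mx q).
Proof. by rewrite adjmx_block !adjmx0 !proj_adj. Qed.

Lemma proj_sum_idem p q : block_mx p 0 0 q *m block_mx p 0 0 q =
  block_mx (proj_mx p) 0 0 (proj_mx q).
Proof. by rewrite mulmx_block !mulmx0 !mul0mx !addr0 !add0r !proj_idem. Qed.

Definition proj_sum p q := Projection (proj_sum_adj p q) (proj_sum_idem p q).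

Definition proj_zero := @Projection 0 0 (adjmx0 0 0) (mulmx0 0 _).

Lemma proj_one_adj : adjmx 1%:M = 1%:M :> 'M[A]_1.
Proof.
apply/matrixP => i j; rewrite !mxE !ord1 /= -[LHS]mulr1 -{2}(starK 1).
by rewrite -starM mulr1 starK.
Qed.

Definition proj_one := Projection proj_one_adj (mulmx1 1%:M).

Lemma mvn_sum p p' q q' :
  mvn_rel p p' -> mvn_rel q q' -> mvn_rel (proj_sum p q) (proj_sum p' q').
Proof.
move=> /mvn_relP[v [vp vp']] /mvn_relP[w [wq wq']]; apply/mvn_relP.
exists (block_mx v 0 0 w); rewrite adjmx_block !adjmx0 !mulmx_block.
by rewrite !mulmx0 !mul0mx !addr0 !add0r vp vp' wq wq'.
Qed.

Lemma mvn_sumC p q : mvn_rel (proj_sum p q) (proj_sum q p).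
Proof.
apply/mvn_relP; exists (block_mx 0 (proj_mx q) (proj_mx p) 0).
rewrite adjmx_block !adjmx0 !mulmx_block.
by rewrite !proj_adj !mulmx0 !mul0mx !addr0 !add0r !proj_idem.
Qed.

Lemma mvn_sum0 p : mvn_rel (proj_sum proj_zero p) p.
Proof.
apply/mvn_relP; exists (row_mx 0 (proj_mx p)).
rewrite adjmx_row mul_col_row mul_row_col adjmx0 !mulmx0 !mul0mx add0r.
by rewrite proj_adj proj_idem.
Qed.

Lemma mvn_cast p q (e : proj_dim p = proj_dim q) :
  proj_mx q = castmx (e, e) (proj_mx p) -> mvn_rel p q.
Proof.
case: p q e => n p p_adj p_idem [m q q_adj q_idem] /= e.
subst m; rewrite castmx_id => qp; subst q.
by apply/mvn_relP; exists p; rewrite /= p_adj.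
Qed.

Lemma mvn_sumA p q r :
  mvn_rel (proj_sum (proj_sum p q) r) (proj_sum p (proj_sum q r)).
Proof.
have e := esym (addnA (proj_dim p) (proj_dim q) (proj_dim r)).
apply: (@mvn_cast (proj_sum (proj_sum p q) r) (proj_sum p (proj_sum q r)) e).
have := @block_mxA A _ _ _ _ _ _ (proj_mx p) 0 0 0 (proj_mx q) 0 0 0 (proj_mx r).
rewrite /= !row_mx0 !col_mx0 => ->; congr castmx.
by congr pair; exact: eq_irrelevance.
Qed.

Definition mvn_class := {eq_quot mvn_equiv}%qT.

HB.instance Definition _ := Choice.on mvn_class.
HB.instance Definition _ := EqQuotient.on mvn_class.

Definition mvn_pi p : mvn_class := (\pi_mvn_class p)%qT.

Lemma mvn_piP p q : mvn_pi p = mvn_pi q <-> mvn_rel p q.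
Proof. by split=> [/eqmodP|?]; last exact/eqmodP. Qed.

Lemma mvn_reprK (a : mvn_class) : mvn_pi (repr a) = a.
Proof. exact: reprK. Qed.

Definition mvn_add (a b : mvn_class) : mvn_class :=
  mvn_pi (proj_sum (repr a) (repr b)).

Lemma mvn_addE p q : mvn_add (mvn_pi p) (mvn_pi q) = mvn_pi (proj_sum p q).
Proof. by apply/mvn_piP/mvn_sum; apply/mvn_piP; exact: mvn_reprK. Qed.

Lemma mvn_addA : associative mvn_add.
Proof.
move=> a b c; rewrite -(mvn_reprK a) -(mvn_reprK b) -(mvn_reprK c).
by rewrite !mvn_addE; apply/esym/mvn_piP/mvn_sumA.
Qed.

Lemma mvn_addC : commutative mvn_add.
Proof.
move=> a b; rewrite -(mvn_reprK a) -(mvn_reprK b) !mvn_addE.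
exact/mvn_piP/mvn_sumC.
Qed.

Lemma mvn_add0 : left_id (mvn_pi proj_zero) mvn_add.
Proof.
by move=> a; rewrite -(mvn_reprK a) mvn_addE; apply/mvn_piP/mvn_sum0.
Qed.

HB.instance Definition _ := GRing.isNmodule.Build mvn_class
  mvn_addA mvn_addC mvn_add0.

Definition K0 := grothendieck mvn_class.

HB.instance Definition _ := GRing.Zmodule.on K0.

Definition K0_class p : K0 := groth_class (mvn_pi p).

End Projections.

Arguments K0 {C} A.
Arguments proj_one {C} A.

(* Main.v *)
(** Let N+ and N- be the sets of neighbours of O of type one more and one less
    than that of O, and let U_z, for z in N+, be the set of boundary points w
    such that z lies in the sector [O, w). The clopen sets U_z partition the
    boundary. For x in N-, the vertex O lies in [x, w) if and only if the vertex
    of N+ on [O, w) is not adjacent to x, so {w | O in [x, w)} is the union of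
    the U_z for z not adjacent to x. As the group is simply transitive and type
    rotating, x = g O for a unique z in N+ with g z = O, and then this set is
    g U_z, whose indicator function has the same class in K_0 as that of U_z.
    In the link of O, a projective plane of order q, every point z is off
    exactly q^2 lines x, so summing over x gives [1] = q^2 [1].

    On the building side, everything is reduced to "flat" maps k from the
    quadrant N x N to the vertices: those that look locally like a sector, in
    that rows and columns go straight through every link. A flat map can be
    prolonged by a new column, which the projective planes that are the links
    determine from its first vertex, and thus to the whole plane. Its finite
    rectangles lie in apartments, as a retraction centred at a chamber shows
    that a vertex has at most one predecessor of each type towards a given
    origin; and the complete apartment system contains all limits of
    apartments. *)

Require Import Defs.
From mathcomp Require Import all_boot all_order all_algebra.
From mathcomp Require Import complex.
From mathcomp Require Import all_classical all_reals all_analysis.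
From mathcomp Require Import zify ring.

Set Implicit Arguments.
Unset Strict Implicit.
Unset Printing Implicit Defensive.

Import Order.TTheory GRing.Theory Num.Theory.
Import numFieldNormedType.Exports.

Local Open Scope classical_set_scope.
Local Open Scope ring_scope.

(** * The triangular tiling of the plane *)

(** The ball of radius [k] for the graph distance: the neighbours of the origin are [e1], [e2],
    [e2 - e1] and their opposites, so balls are hexagons, given by bounds on [x], [y] and
    [x + y]. *)
Definition plane_dist_le (k : int) (p q : int * int) : bool :=
  [&& - k <= q.1 - p.1, q.1 - p.1 <= k, - k <= q.2 - p.2, q.2 - p.2 <= k,
      - k <= q.1 - p.1 + (q.2 - p.2) & q.1 - p.1 + (q.2 - p.2) <= k].

Definition plane_adj (p q : int * int) : bool :=
  plane_dist_le 1 p q && ((p.1 != q.1) || (p.2 != q.2)).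

Lemma plane_adjP p q : plane_adj p q ->
  [\/ [\/ q = (p.1 + 1, p.2), q = (p.1, p.2 + 1) | q = (p.1 - 1, p.2 + 1)]
   | [\/ q = (p.1 - 1, p.2), q = (p.1, p.2 - 1) | q = (p.1 + 1, p.2 - 1)]].
Proof.
case: p q => [a b] [c d]; rewrite /plane_adj /plane_dist_le /= => h.
have : [|| (c == a + 1) && (d == b), (c == a) && (d == b + 1),
    (c == a - 1) && (d == b + 1), (c == a - 1) && (d == b),
    (c == a) && (d == b - 1) | (c == a + 1) && (d == b - 1)] by lia.
case/or3P; last case/or4P.
all: case/andP => /eqP-> /eqP->.
- by left; constructor 1.
- by left; constructor 2.
- by left; constructor 3.
- by right; constructor 1.
- by right; constructor 2.
- by right; constructor 3.
Qed.

Lemma up_triangleE i j a b :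
  up_triangle i j (a, b) <->
  [|| (a == i) && (b == j), (a == i + 1) && (b == j) | (a == i) && (b == j
    + 1)].
Proof.
split=> [[[|]|] [-> ->]|]; rewrite ?eqxx ?orbT //.
by case/or3P => /andP[/eqP-> /eqP->]; [left; left|left; right|right].
Qed.

Lemma down_triangleE i j a b :
  down_triangle i j (a, b) <->
  [|| (a == i + 1) && (b == j), (a == i) && (b == j + 1) |
      (a == i + 1) && (b == j + 1)].
Proof.
split=> [[[|]|] [-> ->]|]; rewrite ?eqxx ?orbT //.
by case/or3P => /andP[/eqP-> /eqP->]; [left; left|left; right|right].
Qed.

Lemma plane_simplex_triangle p q r : plane_adj p q -> plane_adj q r ->
  plane_adj p r -> plane_simplex [set p; q; r].
Proof.
move=> /plane_adjP pq qr /plane_adjP pr; split; first by exists p; left; left.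
have up i j : p \in [:: (i, j); (i + 1, j); (i, j + 1)] ->
    q \in [:: (i, j); (i + 1, j); (i, j + 1)] ->
    r \in [:: (i, j); (i + 1, j); (i, j + 1)] ->
    exists2 c, plane_chamber c & [set p; q; r] `<=` c.
  move=> hp hq hr; exists (up_triangle i j); first by exists i, j; left.
  by move=> _ [[|]|] ->; [move: hp|move: hq|move: hr]; rewrite !inE;
    (case/or3P => /eqP ->; [left; left|left; right|right]).
have down i j : p \in [:: (i + 1, j); (i, j + 1); (i + 1, j + 1)] ->
    q \in [:: (i + 1, j); (i, j + 1); (i + 1, j + 1)] ->
    r \in [:: (i + 1, j); (i, j + 1); (i + 1, j + 1)] ->
    exists2 c, plane_chamber c & [set p; q; r] `<=` c.
  move=> hp hq hr; exists (down_triangle i j); first by exists i, j; right.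
  by move=> _ [[|]|] ->; [move: hp|move: hq|move: hr]; rewrite !inE;
    (case/or3P => /eqP ->; [left; left|left; right|right]).
case: p pq pr up down => a b pq pr up down.
(* The six triangles at the vertex [(a, b)], three of each kind. *)
move: (up a b) (up (a - 1) b) (up a (b - 1)).
move: (down (a - 1) (b - 1)) (down a (b - 1)) (down (a - 1) b).
rewrite !subrK !inE !xpair_eqE !eqxx /= ?orbT => {}down d1 d2 {}up u1 u2.
case: pq => -[] qE; case: pr => -[] rE.
all: move: qr up u1 u2 down d1 d2; rewrite {}qE {}rE /= !xpair_eqE /=.
all: move=> qr up u1 u2 down d1 d2.
all: try (exfalso; move: qr; rewrite /plane_adj /plane_dist_le /=; lia).
all: by [apply: up; lia|apply: u1; lia|apply: u2; lia|apply: down; lia|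
         apply: d1; lia|apply: d2; lia].
Qed.

Lemma plane_simplex_adj s p q : plane_simplex s -> s p -> s q ->
  p = q \/ plane_adj p q.
Proof.
case=> _ [c [i [j cE]] sc] /sc cp /sc; case: p q cp => [a b] [c' d].
case: cE => ->; [move=> /up_triangleE + /up_triangleE|
                 move=> /down_triangleE + /down_triangleE] => h1 h2.
  have [/andP[/eqP-> /eqP->]|h] := boolP ((a == c') && (b == d)); first by left.
  by right; rewrite /plane_adj /plane_dist_le /=; lia.
have [/andP[/eqP-> /eqP->]|h] := boolP ((a == c') && (b == d)); first by left.
by right; rewrite /plane_adj /plane_dist_le /=; lia.
Qed.

Lemma plane_third p q : plane_adj p q ->
  exists2 r, plane_adj p r & plane_adj q r.
Proof.
(* The witness is [q] turned about [p] by pi / 3; this rotation maps [(x, y)] to [(- y, x + y)]. *)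
case: p q => [a b] [c d] pq; exists (a - (d - b), b + (c - a) + (d - b)).
all: by move: pq; rewrite /plane_adj /plane_dist_le /=; lia.
Qed.

(** Only two triangles contain the edge [bc], and their apexes are mirror images in it. *)
Lemma plane_reflect a b c d : plane_adj a b -> plane_adj a c ->
  plane_adj b c -> plane_adj b d -> plane_adj c d -> a <> d ->
  d = (b.1 + c.1 - a.1, b.2 + c.2 - a.2).
Proof.
case: a => a1 a2 /plane_adjP /= bE /plane_adjP /= cE bc bd cd.
suff : [|| (a1 == d.1) && (a2 == d.2) |
    (d.1 == b.1 + c.1 - a1) && (d.2 == b.2 + c.2 - a2)].
  case: d {bd cd} => d1 d2 /= /orP[|] /andP[/eqP-> /eqP->] //.
by case: bE bc bd cd => -[] -> /=; case: cE => -[] -> /=;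
  rewrite /plane_adj /plane_dist_le /=; lia.
Qed.

(** The recurrences are the parallelogram rule for the three kinds of rhombus made of two adjacent
    triangles; they make the increments along both axes constant. *)
Lemma grid_affine (h : nat -> nat -> int) :
  (forall i j, h i.+1 j.+1 = h i.+1 j + h i j.+1 - h i j) ->
  (forall i j, h i.+2 j = h i.+1 j + h i.+1 j.+1 - h i j.+1) ->
  (forall i j, h i j.+2 = h i j.+1 + h i.+1 j.+1 - h i.+1 j) ->
  forall i j, h i j = h 0%N 0%N + i%:Z * (h 1%N 0%N - h 0%N 0%N)
    + j%:Z * (h 0%N 1%N - h 0%N 0%N).
Proof.
move=> h1 h2 h3.
have hi i j : h i.+1 j - h i j = h 1%N 0%N - h 0%N 0%N.
  elim: i j => [j|i IHi j]; last by rewrite h2 -(IHi j.+1); lia.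
  by elim: j => // j IHj; rewrite -IHj h1; lia.
have hj j : h 0%N j.+1 - h 0%N j = h 0%N 1%N - h 0%N 0%N.
  elim: j => // j IHj; rewrite -IHj (h3 0%N j).
  move: (hi 0%N j.+1) (hi 0%N j). lia.
move=> i j; elim: i => [|i IHi].
  elim: j => [|j IHj]; first by lia.
  by have := hj j; rewrite IHj; lia.
by have := hi i j; rewrite IHi; lia.
Qed.

Definition quadrant (n : nat) (p : int * int) : bool :=
  (- n%:Z <= p.1) && (- n%:Z <= p.2).

(** Injectivity keeps the two triangles of a rhombus from being folded onto each other, so
    [plane_reflect] gives the recurrences of [grid_affine] in both coordinates. Quadrants serve both
    for sectors, with [n = 0], and for the whole plane, with [n] growing. *)
Lemma plane_affine (n : nat) (f : int * int -> int * int) :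
  (forall p q, quadrant n p -> quadrant n q ->
     plane_adj p q -> plane_adj (f p) (f q)) ->
  (forall p q, quadrant n p -> quadrant n q -> f p = f q -> p = q) ->
  forall p, quadrant n p ->
  f p = ((f (0, 0)).1 + p.1 * ((f (1, 0)).1 - (f (0, 0)).1)
           + p.2 * ((f (0, 1)).1 - (f (0, 0)).1),
         (f (0, 0)).2 + p.1 * ((f (1, 0)).2 - (f (0, 0)).2)
           + p.2 * ((f (0, 1)).2 - (f (0, 0)).2)).
Proof.
move=> f_adj f_inj.
pose h (i j : nat) := f (i%:Z - n%:Z, j%:Z - n%:Z).
have hadj i j k l : plane_adj (i%:Z, j%:Z) (k%:Z, l%:Z) ->
    plane_adj (h i j) (h k l).
  move=> ik; apply: f_adj; rewrite /quadrant /=; try lia.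
  by move: ik; rewrite /plane_adj /plane_dist_le /=; lia.
have hinj i j k l : h i j = h k l -> i = k /\ j = l.
  move/f_inj; rewrite /quadrant /= => H.
  have := H ltac:(lia) ltac:(lia); case=> e1 e2; split; lia.
have A i j : [/\ h i.+1 j.+1 = ((h i.+1 j).1 + (h i j.+1).1 - (h i j).1,
                          (h i.+1 j).2 + (h i j.+1).2 - (h i j).2),
    h i.+2 j = ((h i.+1 j).1 + (h i.+1 j.+1).1 - (h i j.+1).1,
                (h i.+1 j).2 + (h i.+1 j.+1).2 - (h i j.+1).2) &
    h i j.+2 = ((h i j.+1).1 + (h i.+1 j.+1).1 - (h i.+1 j).1,
                (h i j.+1).2 + (h i.+1 j.+1).2 - (h i.+1 j).2)].
  split; apply: plane_reflect; try (by apply: hadj;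
    rewrite /plane_adj /plane_dist_le /=; lia).
  - by move/hinj => [e1 e2]; lia.
  - by move/hinj => [e1 e2]; lia.
  - by move/hinj => [e1 e2]; lia.
have h1E := @grid_affine (fun i j => (h i j).1).
have h2E := @grid_affine (fun i j => (h i j).2).
have {}h1E : forall i j, _ := h1E
  (fun i j => let: And3 e _ _ := A i j in congr1 fst e)
  (fun i j => let: And3 _ e _ := A i j in congr1 fst e)
  (fun i j => let: And3 _ _ e := A i j in congr1 fst e).
have {}h2E : forall i j, _ := h2E
  (fun i j => let: And3 e _ _ := A i j in congr1 snd e)
  (fun i j => let: And3 _ e _ := A i j in congr1 snd e)
  (fun i j => let: And3 _ _ e := A i j in congr1 snd e).
have fE p : quadrant n p -> f p = h (absz (p.1 + n%:Z)) (absz (p.2 + n%:Z)).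
  by case: p => a b; rewrite /quadrant /h /= => ab; congr f; congr pair; lia.
move=> p pn.
have [q0 q1 q2] : [/\ quadrant n (0, 0), quadrant n (1, 0) & quadrant n (0, 1)].
  by rewrite /quadrant /=; split; lia.
rewrite (fE _ pn) (fE _ q0) (fE _ q1) (fE _ q2) /=.
rewrite [LHS]surjective_pairing.
have := h1E (absz (p.1 + n%:Z)) (absz (p.2 + n%:Z)).
have := h2E (absz (p.1 + n%:Z)) (absz (p.2 + n%:Z)).
have := h1E (absz (0 + n%:Z)) (absz (0 + n%:Z)).
have := h2E (absz (0 + n%:Z)) (absz (0 + n%:Z)).
have := h1E (absz (1 + n%:Z)) (absz (0 + n%:Z)).
have := h2E (absz (1 + n%:Z)) (absz (0 + n%:Z)).
have := h1E (absz (0 + n%:Z)) (absz (1 + n%:Z)).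
have := h2E (absz (0 + n%:Z)) (absz (1 + n%:Z)).
rewrite /= => -> -> -> -> -> -> -> ->.
have -> : (absz (p.1 + n%:Z))%:Z = p.1 + n%:Z by move: pn; rewrite /quadrant;
  lia.
have -> : (absz (p.2 + n%:Z))%:Z = p.2 + n%:Z by move: pn; rewrite /quadrant;
  lia.
have -> : (absz (0 + n%:Z))%:Z = n%:Z by lia.
have -> : (absz (1 + n%:Z))%:Z = 1 + n%:Z by lia.
by congr pair; ring.
Qed.

(** * Charts and retractions *)

(** Two edge vectors of a triangle form a basis of the lattice, so a linear form that vanishes on
    both is zero. *)
Lemma plane_triangle_basis (y z a b c d e g : int) : plane_adj (a, b) (c, d) ->
    plane_adj (c, d) (e, g) -> plane_adj (a, b) (e, g) ->
    (c - a) * y + (d - b) * z = 0 -> (e - a) * y + (g - b) * z = 0 ->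
    y = 0 /\ z = 0.
Proof.
have e0 (x k : int) : x + k - x = k by lia.
move=> /plane_adjP /= ab h /plane_adjP /= ad.
case: ab h ad => -[] [-> ->] h [] [] [eE gE]; move: h; rewrite {}eE {}gE.
all: by rewrite /plane_adj /plane_dist_le /= !(subrr, e0); lia.
Qed.

Section Building.
Variable B : A2_building.
Implicit Types (A : set (set B)) (phi : int * int -> B) (s t : set B).

Definition adj (x y : B) := x <> y /\ simplex [set x; y].

Lemma adj_sym x y : adj x y -> adj y x.
Proof. by case=> xy xys; split; [move=> yx; exact: xy|rewrite setUC]. Qed.

Lemma plane_adj_neq p q : plane_adj p q -> p <> q.
Proof.
by move=> + pq; rewrite pq => /andP[_]; rewrite !eqxx.
Qed.

Lemma plane_simplex_edge p q : plane_adj p q -> plane_simplex [set p; q].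
Proof.
move=> pq; have [r pr qr] := plane_third pq.
have [_ [c cP sc]] := plane_simplex_triangle pq qr pr.
split; first by exists p; left.
by exists c => // u [->|->]; apply: sc; left; [left|right].
Qed.

Lemma apartment_simplex A s : apartment A -> A s -> simplex s.
Proof. by move=> AA; exact: apartment_sub (apartmentP B) _ AA _. Qed.

Lemma chart_mem A phi s : chart A phi ->
  A s <-> exists2 u, plane_simplex u & s = phi @` u.
Proof. by case=> _ <-; split=> -[u]; [move=> uP <-|move=> uP ->]; exists u. Qed.

Lemma chart_point A phi s x : chart A phi -> A s -> s x ->
  exists p, x = phi p.
Proof. by move=> cA /(chart_mem _ cA)[u _ ->] [p _ <-]; exists p. Qed.

Lemma chart_edge A phi s p q : chart A phi -> A s -> s (phi p) -> s (phi q) ->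
  p <> q -> plane_adj p q.
Proof.
move=> cA /(chart_mem _ cA)[u uP ->] [p' up' /(cA.1) <-] [q' uq' /(cA.1) <-].
by case: (plane_simplex_adj uP up' uq').
Qed.

Lemma chart_adj A phi p q : apartment A -> chart A phi -> plane_adj p q ->
  adj (phi p) (phi q).
Proof.
move=> AA cA pq; split; first by move/(cA.1); exact: plane_adj_neq.
apply: (apartment_simplex AA); apply/(chart_mem _ cA).
by exists [set p; q];
  [exact: plane_simplex_edge|rewrite image_setU !image_set1].
Qed.

Lemma chart_triangle A phi p q r : chart A phi ->
  plane_adj p q -> plane_adj q r -> plane_adj p r ->
  A [set phi p; phi q; phi r].
Proof.
move=> cA pq qr pr; apply/(chart_mem _ cA).
exists [set p; q; r]; first exact: plane_simplex_triangle.
by rewrite !image_setU !image_set1.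
Qed.

Lemma chart_vertex A phi p : chart A phi -> A [set phi p].
Proof.
move=> cA; apply/(chart_mem _ cA); exists [set p]; last by rewrite image_set1.
split; first by exists p.
exists (up_triangle p.1 p.2); first by exists p.1, p.2; left.
by move=> _ ->; left; left; case: p.
Qed.

Lemma apartment_common s t : simplex s -> simplex t ->
  exists A phi, [/\ apartment A, chart A phi, A s & A t].
Proof.
move=> sS tS; have [A [AA As At]] := apartment_join (apartmentP B) sS tS.
by have [phi cA] := apartment_chart (apartmentP B) AA; exists A, phi.
Qed.

Lemma chart_transfer A A' phi s t : apartment A -> apartment A' ->
  chart A phi -> A s -> A t -> A' s -> A' t ->
  exists2 phi', chart A' phi' &
    forall p, s (phi p) \/ t (phi p) -> phi' p = phi p.
Proof.
move=> AA AA' cA As At A's A't.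
have [psi [psi_inj psiE] psi_fix] :=
  apartment_iso (apartmentP B) AA AA' As At A's A't.
exists (psi \o phi); last by move=> p sp /=; exact: psi_fix.
have mA p : (\bigcup_(s in A) s) (phi p).
  by exists [set phi p] => //; exact: chart_vertex cA.
split.
  by move=> p q /= e; apply: cA.1; apply: psi_inj; rewrite ?inE.
rewrite -psiE -cA.2 image_comp; apply: eq_imagel => u _.
by rewrite /= image_comp.
Qed.

(** The change of coordinates is injective and preserves adjacency, and every point lies in some
    quadrant, so [plane_affine] applies. *)
Lemma chart_affine A phi phi' : apartment A -> chart A phi -> chart A phi' ->
  exists f : int * int -> int * int, [/\ forall p, phi' (f p) = phi p,
    forall p q, plane_adj p q -> plane_adj (f p) (f q) &
    forall p, f p =
      ((f (0, 0)).1 + p.1 * ((f (1, 0)).1 - (f (0, 0)).1)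
         + p.2 * ((f (0, 1)).1 - (f (0, 0)).1),
       (f (0, 0)).2 + p.1 * ((f (1, 0)).2 - (f (0, 0)).2)
         + p.2 * ((f (0, 1)).2 - (f (0, 0)).2))].
Proof.
move=> AA cA cA'.
have /choice[f fE] : forall p, exists q, phi' q = phi p.
  move=> p; have [q qE] := chart_point cA' (chart_vertex p cA) erefl.
  by exists q.
have f_adj p q : plane_adj p q -> plane_adj (f p) (f q).
  move=> pq; apply: (@chart_edge A phi' [set phi p; phi q]) => //.
  - apply/(chart_mem _ cA); exists [set p; q]; first exact: plane_simplex_edge.
    by rewrite image_setU !image_set1.
  - by left.
  - by right.
  - by move=> fpq; apply: (plane_adj_neq pq); apply: cA.1; rewrite -!fE fpq.
exists f; split=> // p.
apply: (@plane_affine (absz p.1 + absz p.2)%N).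
- by move=> *; exact: f_adj.
- by move=> x y _ _ xy; apply: cA.1; rewrite -!fE xy.
- by rewrite /quadrant; lia.
Qed.

Lemma chart_rigid A phi phi' p q r : apartment A -> chart A phi ->
  chart A phi' -> plane_adj p q -> plane_adj q r -> plane_adj p r ->
  phi p = phi' p -> phi q = phi' q -> phi r = phi' r -> phi =1 phi'.
Proof.
move=> AA cA cA' pq qr pr ep eq er.
have [f [fE f_adj f_aff]] := chart_affine AA cA cA'.
have fix_f u : phi u = phi' u -> f u = u.
  by move=> e; apply: cA'.1; rewrite fE.
suff fid u : f u = u by move=> u; rewrite -fE fid.
have := fix_f _ ep; have := fix_f _ eq; have := fix_f _ er.
rewrite (f_aff p) (f_aff q) (f_aff r) (f_aff u);
  move: (f (0, 0)) (f (1, 0)) (f (0, 1)).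
move=> [t1 t2] [u1 u2] [v1 v2] /= r12 q12 p12.
(* In each coordinate, [f] minus the identity is affine and vanishes at the vertices of a triangle.
   Subtracting the equations isolates its linear part, which is zero by [plane_triangle_basis]. *)
have solve (t y z a b c d e g : int) : t + a * y + b * z = 0 ->
    t + c * y + d * z = 0 -> t + e * y + g * z = 0 ->
    (c - a) * y + (d - b) * z = 0 /\ (e - a) * y + (g - b) * z = 0.
  by move=> h1 h2 h3; rewrite !mulrBl; split; lia.
case: p q r u {f_adj f_aff fix_f fE ep eq er} pq qr pr p12 q12 r12 =>
  [a b] [c d] [e g] [i j] pq qr pr /= [p1 p2] [q1 q2] [r1 r2].
have [h1 h2] : u1 - t1 - 1 = 0 /\ v1 - t1 = 0.
  have [] := @solve t1 (u1 - t1 - 1) (v1 - t1) a b c d e g; [lia|lia|lia|].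
  exact: plane_triangle_basis.
have [h3 h4] : u2 - t2 = 0 /\ v2 - t2 - 1 = 0.
  have [] := @solve t2 (u2 - t2) (v2 - t2 - 1) a b c d e g; [lia|lia|lia|].
  exact: plane_triangle_basis.
have [d1 d2 d3 d4] : [/\ u1 - t1 = 1, v1 - t1 = 0, u2 - t2 = 0 & v2 - t2 = 1].
  by split; lia.
by rewrite d1 d2 d3 d4 in p1 p2 *; congr pair; lia.
Qed.

(* Retraction onto the apartment [A], centred at the chamber with vertices
   [phi p], [phi q] and [phi r], and read in the chart [phi]. *)
Lemma retraction A phi p q r : apartment A -> chart A phi ->
  plane_adj p q -> plane_adj q r -> plane_adj p r ->
  exists rho : B -> int * int, [/\ forall u, rho (phi u) = u,
    forall x y, adj x y -> plane_adj (rho x) (rho y) &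
    forall x, [set p; q; r] (rho x) -> phi (rho x) = x].
Proof.
move=> AA cA pq qr pr; pose c := [set phi p; phi q; phi r].
have Ac : A c := chart_triangle cA pq qr pr.
have cS := apartment_simplex AA Ac.
(* These are the charts, of apartments through [c], that agree with [phi] on [c]; the retraction
   gives the coordinates of a vertex in any of them. *)
pose good A' phi' := [/\ apartment A', chart A' phi', A' c &
   [/\ phi' p = phi p, phi' q = phi q & phi' r = phi r]].
have goodP A' : apartment A' -> A' c -> exists phi', good A' phi'.
  move=> AA' A'c.
  have [phi' cA' e] := chart_transfer AA AA' cA Ac Ac A'c A'c.
  exists phi'; split=> //; split; apply: e; left.
  - by left; left.
  - by left; right.
  - by right.
pose P x u := exists A' phi', good A' phi' /\ phi' u = x.
have P_uniq x u v : P x u -> P x v -> u = v.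
  move=> [A1 [phi1 [[AA1 cA1 A1c [e1 e2 e3]] ue]]].
  move=> [A2 [phi2 [[AA2 cA2 A2c [d1 d2 d3]] ve]]].
  have A1x : A1 [set x] by rewrite -ue; exact: chart_vertex cA1.
  have A2x : A2 [set x] by rewrite -ve; exact: chart_vertex cA2.
  (* The isomorphism fixing [c] and [x] turns [phi1] into a chart of [A2] that agrees with [phi2] on
     [c], hence everywhere by rigidity. *)
  have [phi3 cA3 e] := chart_transfer AA1 AA2 cA1 A1c A1x A2c A2x.
  have phi32 : phi3 =1 phi2.
    apply: (chart_rigid AA2 cA3 cA2 pq qr pr);
      rewrite e ?e1 ?e2 ?e3 ?d1 ?d2 ?d3 //.
    - by left; left; left.
    - by left; left; right.
    - by left; right.
  apply: cA2.1; rewrite ve -phi32 e ?ue//.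
  by right.
have P_good A' phi' u : good A' phi' -> P (phi' u) u by move=> ?;
  exists A', phi'.
have /choice[rho rhoP] : forall x, exists u, P x u.
  move=> x; have [A' [AA' A'c A'x]] :=
    apartment_join (apartmentP B) cS (@simplex_vertex B x).
  have [phi' g] := goodP _ AA' A'c; case: (g) => _ cA' _ _.
  by have [u ->] := chart_point cA' A'x erefl; exists u; exact: P_good g.
have gA : good A phi by split.
exists rho; split.
- by move=> u; apply: (P_uniq (phi u)) => //; exact: P_good gA.
- move=> x y [xy xyS].
  have [A' [AA' A'c A'xy]] := apartment_join (apartmentP B) cS xyS.
  have [phi' g] := goodP _ AA' A'c; case: (g) => _ cA' _ _.
  have [u xE] := chart_point cA' A'xy (or_introl erefl).
  have [v yE] := chart_point cA' A'xy (or_intror erefl).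
  have -> : rho x = u by apply: (P_uniq x) => //; rewrite xE; exact: P_good g.
  have -> : rho y = v by apply: (P_uniq y) => //; rewrite yE; exact: P_good g.
  apply: (chart_edge cA' A'xy); rewrite -?xE -?yE; [by left|by right|].
  by move=> uv; apply: xy; rewrite xE yE uv.
- move=> x; have [A' [phi' [[_ _ _ [e1 e2 e3]] xE]]] := rhoP x.
  by rewrite -[in RHS]xE; move=> [[]|] ->.
Qed.

End Building.

(** The tiling has no four mutually adjacent points. *)
Lemma plane_clique4 p q r u : plane_adj p q -> plane_adj q r ->
  plane_adj p r -> p = u \/ plane_adj p u -> q = u \/ plane_adj q u ->
  r = u \/ plane_adj r u -> [set p; q; r] u.
Proof.
move=> pq qr pr [<-|pu]; first by left; left.
case=> [<-|qu]; first by left; right.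
case=> [<-|ru]; first by right.
have [e|ne] := eqVneq r u; first by right; rewrite e.
have e := plane_reflect pq pu qu qr.
exfalso.
case: p q u r {e ne} pq pu qu qr pr ru => a b [c d] [e f] [g h].
move=> /plane_adjP /= [] [] [-> ->].
all: rewrite /plane_adj /plane_dist_le /=; lia.
Qed.

Lemma plane_simplex_sub s t : plane_simplex s -> t `<=` s -> t !=set0 ->
  plane_simplex t.
Proof.
by case=> _ [c cP sc] ts t0; split=> //; exists c => // x /ts /sc.
Qed.

Lemma plane_simplex_third s p q : plane_simplex s -> s p -> s q ->
  plane_adj p q ->
  exists r, [/\ plane_adj p r, plane_adj q r & s `<=` [set p; q; r]].
Proof.
move=> sP sp sq pq.
have [[r [sr rp rq]]|H] := pselect (exists r, [/\ s r, r <> p & r <> q]).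
  have [/esym//|pr] := plane_simplex_adj sP sp sr.
  have [/esym//|qr] := plane_simplex_adj sP sq sr.
  exists r; split=> // u su; apply: plane_clique4 => //.
  - exact: plane_simplex_adj sP sp su.
  - exact: plane_simplex_adj sP sq su.
  - exact: plane_simplex_adj sP sr su.
have [r pr qr] := plane_third pq; exists r; split=> // u su.
have [->|up] := pselect (u = p); first by left; left.
have [->|uq] := pselect (u = q); first by left; right.
by exfalso; apply: H; exists u.
Qed.

Lemma plane_simplex_in_triangle s p : plane_simplex s -> s p ->
  exists q r, [/\ plane_adj p q, plane_adj q r, plane_adj p r &
    s `<=` [set p; q; r]].
Proof.
move=> sP sp; have [[q [sq qp]]|H] := pselect (exists q, s q /\ q <> p).
  have [/esym//|pq] := plane_simplex_adj sP sp sq.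
  by have [r [pr qr sr]] := plane_simplex_third sP sp sq pq; exists q, r.
have pq : plane_adj p (p.1 + 1, p.2).
  by rewrite /plane_adj /plane_dist_le /=; lia.
have [r pr qr] := plane_third pq.
exists (p.1 + 1, p.2), r; split=> // u su; left; left.
by apply: contrapT => up; apply: H; exists u.
Qed.

(** Every simplex of the tiling lies in a triangle of mutually adjacent points, so a map that
    preserves adjacency sends simplices to simplices. *)
Lemma chart_symmetry (B : A2_building) (A : set (set B)) phi
    (f g : int * int -> int * int) :
  chart A phi -> cancel f g -> cancel g f ->
  (forall p q, plane_adj p q -> plane_adj (f p) (f q)) ->
  (forall p q, plane_adj p q -> plane_adj (g p) (g q)) ->
  chart A (phi \o f).
Proof.
have key h s : (forall p q, plane_adj p q -> plane_adj (h p) (h q)) ->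
    plane_simplex s -> plane_simplex (h @` s).
  move=> h_adj sP; have [p sp] := sP.1.
  have [q [r [pq qr pr sub]]] := plane_simplex_in_triangle sP sp.
  apply: (@plane_simplex_sub [set h p; h q; h r]).
  - by apply: plane_simplex_triangle; exact: h_adj.
  - by move=> _ [u /sub[[|]|] -> <-]; [left; left|left; right|right].
  - by exists (h p); exists p.
move=> cA fK gK f_adj g_adj; split; first exact: inj_comp cA.1 (can_inj fK).
rewrite -cA.2; apply/seteqP; split=> _ [s sP <-].
  by exists (f @` s); [exact: key|rewrite image_comp].
exists (g @` s); first exact: key.
by rewrite image_comp; apply: eq_imagel => p _ /=; rewrite gK.
Qed.

Lemma chart_translate (B : A2_building) (A : set (set B)) phi (a b : int) :
  chart A phi -> chart A (fun p => phi (p.1 + a, p.2 + b)).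
Proof.
move=> cA; apply: (@chart_symmetry _ _ _ (fun p => (p.1 + a, p.2 + b))
  (fun p => (p.1 - a, p.2 - b))) => // -[i j].
- by rewrite /= !addrK.
- by rewrite /= !subrK.
- by case=> k l; rewrite /plane_adj /plane_dist_le /=; lia.
- by case=> k l; rewrite /plane_adj /plane_dist_le /=; lia.
Qed.

Lemma chart_swap (B : A2_building) (A : set (set B)) phi :
  chart A phi -> chart A (fun p => phi (p.2, p.1)).
Proof.
move=> cA; apply: (@chart_symmetry _ _ _ (fun p => (p.2, p.1))
  (fun p => (p.2, p.1))) => // -[i j] // [k l].
all: by rewrite /plane_adj /plane_dist_le /=; lia.
Qed.

(** The reflection in the axis of [e1], which exchanges [e2] and [e1 - e2]. *)
Lemma chart_reflect (B : A2_building) (A : set (set B)) phi :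
  chart A phi -> chart A (fun p => phi (p.1 + p.2, - p.2)).
Proof.
move=> cA; apply: (@chart_symmetry _ _ _ (fun p => (p.1 + p.2, - p.2))
  (fun p => (p.1 + p.2, - p.2))) => // -[i j] /=.
- by congr pair; lia.
- by congr pair; lia.
- by case=> k l; rewrite /plane_adj /plane_dist_le /=; lia.
- by case=> k l; rewrite /plane_adj /plane_dist_le /=; lia.
Qed.

(** The rotation by 2 pi / 3 about the origin, which maps [e1] to [e2 - e1]. *)
Lemma chart_rotate (B : A2_building) (A : set (set B)) phi :
  chart A phi -> chart A (fun p => phi (- p.1 - p.2, p.1)).
Proof.
move=> cA; apply: (@chart_symmetry _ _ _ (fun p => (- p.1 - p.2, p.1))
  (fun p => (p.2, - p.1 - p.2))) => // -[i j] /=.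
- by congr pair; lia.
- by congr pair; lia.
- by case=> k l; rewrite /plane_adj /plane_dist_le /=; lia.
- by case=> k l; rewrite /plane_adj /plane_dist_le /=; lia.
Qed.

(** * Links of vertices *)

Section Links.
Variable B : A2_building.
Implicit Types (x y z w : B).

Inductive reach (x : B) : nat -> B -> Prop :=
| reach0 : reach x 0 x
| reachS k y z : reach x k y -> adj y z -> reach x k.+1 z.

Lemma reach_plane (rho : B -> int * int) x k y :
  (forall x y, adj x y -> plane_adj (rho x) (rho y)) ->
  reach x k y -> plane_dist_le k (rho x) (rho y).
Proof.
move=> rho_adj; elim=> [|{}k {}y z _ IH /rho_adj].
  by rewrite /plane_dist_le; lia.
by move: IH; rewrite /plane_adj /plane_dist_le; lia.
Qed.

Lemma chart_retraction (A : set (set B)) phi : apartment A -> chart A phi ->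
  exists rho : B -> int * int, (forall u, rho (phi u) = u) /\
    forall x y, adj x y -> plane_adj (rho x) (rho y).
Proof.
move=> AA cA.
have [rho [? ? _]] :=
  @retraction B A phi (0, 0) (1, 0) (0, 1) AA cA erefl erefl erefl.
by exists rho.
Qed.

(** The axioms do not say directly that an edge of the building with both ends in [A] belongs to
    [A]; the retraction onto [A] shows it. *)
Lemma chart_adjE (A : set (set B)) phi p q : apartment A -> chart A phi ->
  adj (phi p) (phi q) <-> plane_adj p q.
Proof.
move=> AA cA; split; last exact: (chart_adj AA cA).
have [rho [rK rho_adj]] := chart_retraction AA cA.
by move/rho_adj; rewrite !rK.
Qed.

Lemma adj_simplex3 x y z : adj x y -> adj y z -> adj x z ->
  simplex [set x; y; z].
Proof.
move=> xy yz xz; have [A [phi [AA cA Axy Az]]] :=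
  apartment_common xy.2 (@simplex_vertex B z).
have [p pE] := chart_point cA Axy (or_introl erefl).
have [q qE] := chart_point cA Axy (or_intror erefl).
have [r rE] := chart_point cA Az erefl.
subst x y z; apply: (apartment_simplex AA); apply: (chart_triangle cA).
all: by apply/(chart_adjE _ _ AA cA).
Qed.

Lemma simplex_third s x y : simplex s -> s x -> s y -> adj x y ->
  exists z, [/\ adj x z, adj y z & s `<=` [set x; y; z]].
Proof.
move=> sS sx sy xy; have [A [phi [AA cA As _]]] := apartment_common sS sS.
have [u uP sE] := (chart_mem _ cA).1 As; subst s.
case: sx sy => p up px [q uq qy]; subst x y.
have pq : plane_adj p q by apply/(chart_adjE _ _ AA cA).
have [r [pr qr sub]] := plane_simplex_third uP up uq pq.
exists (phi r); split;
  [exact: (chart_adj AA cA pr)|exact: (chart_adj AA cA qr)|].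
by move=> _ [v /sub[[|]|] -> <-]; [left; left|left; right|right].
Qed.

Lemma adj_third x y : adj x y -> exists z, adj x z /\ adj y z.
Proof.
move=> xy; have [z [xz yz _]] :=
  simplex_third xy.2 (or_introl erefl) (or_intror erefl) xy.
by exists z.
Qed.

(** Otherwise [x], [w], [y], [w'] form a 4-cycle in the link of [b]. The retraction centred at the
    triangle [b], [x], [w] sends it into the hexagon around [b]; it cannot fold [y] onto [x] or [w']
    onto [w], so the images of [y] and [w'] are opposite instead of adjacent. *)
Lemma link_uniq b x y w w' : adj b x -> adj b y -> adj b w -> adj b w' ->
  adj x w -> adj y w -> adj x w' -> adj y w' -> x <> y -> w = w'.
Proof.
move=> bx by_ bw bw' xw yw xw' yw' xy; apply: contrapT => ww'.
have S := adj_simplex3 bx xw bw.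
have [A [phi [AA cA As _]]] := apartment_common S S.
have [p pE] := chart_point cA As (or_introl (or_introl erefl)).
have [q qE] := chart_point cA As (or_introl (or_intror erefl)).
have [r rE] := chart_point cA As (or_intror erefl).
subst b x w; move: bx bw xw => /(chart_adjE _ _ AA cA) pq
  /(chart_adjE _ _ AA cA) pr /(chart_adjE _ _ AA cA) qr.
have [rho [rK rho_adj rho_c]] := retraction AA cA pq qr pr.
have y_q : rho y <> q.
  by move=> e; apply: xy; rewrite -(rho_c y) ?e//; left; right.
have w'_r : rho w' <> r.
  by move=> e; apply: ww'; rewrite -(rho_c w') ?e//; right.
have := rho_adj _ _ by_; have := rho_adj _ _ bw'; have := rho_adj _ _ yw.
have := rho_adj _ _ xw'; have := rho_adj _ _ yw'; rewrite !rK.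
move: y_q w'_r pq pr qr; move: (rho y) (rho w').
have H u v : u <> v -> (u.1 != v.1) || (u.2 != v.2) :> bool.
  case: u v => [a b] [c d] /= ne; rewrite -negb_and; apply/negP.
  by move=> /andP[/eqP ac /eqP bd]; apply: ne; rewrite ac bd.
move=> u v /H uq /H vr /plane_adjP pq /plane_adjP pr qr.
case: pq uq qr => -[] -> /= uq; case: pr vr => -[] -> /= vr.
all: rewrite /plane_adj /plane_dist_le /=; lia.
Qed.

End Links.

(** * Types *)

Lemma Z3_three (x : 'Z_3) : x *+ 3 = 0.
Proof. by rewrite -mulr_natr (_ : 3%:R = 0) ?mulr0//; apply: val_inj. Qed.

Lemma Z3_int0 (k : int) : k%:~R = 0 :> 'Z_3 -> exists m, k = 3 * m.
Proof.
have := divz_eq k 3; have := modz_ge0 k (isT : 3 != 0 :> int).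
have := ltz_pmod k (isT : 0 < 3 :> int).
move: (k %/ 3)%Z (k %% 3)%Z => m r r3 r0 ->; rewrite intrD intrM.
have -> : 3%:~R = 0 :> 'Z_3 by apply: val_inj.
rewrite mulr0 add0r; case: r r3 r0 => [[|[|[|r]]]|r] //= _ _.
by move=> _; exists m; lia.
Qed.

Lemma Z3_sum (x y z : 'Z_3) : x <> y -> y <> z -> x <> z -> x + y + z = 0.
Proof.
move=> xy yz xz; apply/eqP; move: xy yz xz => /eqP + /eqP + /eqP.
have H : [forall x : 'Z_3, forall y : 'Z_3, forall z : 'Z_3,
    [&& x != y, y != z & x != z] ==> (x + y + z == 0)].
  apply/forallP => -[[|[|[|//]]] ?]; apply/forallP => -[[|[|[|//]]] ?];
    by apply/forallP => -[[|[|[|//]]] ?].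
move/forallP/(_ x)/forallP/(_ y)/forallP/(_ z)/implyP: H => H.
by move=> a b c; apply: H; rewrite a b c.
Qed.

Lemma Z3_neq0 (x : 'Z_3) : x <> 0 -> x = 1 \/ x = - 1.
Proof.
case: x => -[|[|[|//]]] i; first by move=> e; case: e; apply: val_inj.
  by move=> _; left; apply: val_inj.
by move=> _; right; apply: val_inj.
Qed.

(** One of the two orientations of a chart: types rise by one along [e1] and fall by one along [e2].
    By [chart_typed], swapping the coordinates corrects a chart of the other orientation. *)
Definition typed (B : A2_building) (tau : B -> 'Z_3) (phi : int * int -> B) :=
  forall p, tau (phi p) = tau (phi (0, 0)) + (p.1 - p.2)%:~R.

Lemma typed_diff (B : A2_building) (tau : B -> 'Z_3) phi p q :
  typed tau phi -> tau (phi q) = tau (phi p) + (q.1 - p.1 - (q.2 - p.2))%:~R.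
Proof.
move=> ty; rewrite (ty q) (ty p) -addrA -intrD; congr (_ + _%:~R); lia.
Qed.

Lemma typed_Z3 (B : A2_building) (tau : B -> 'Z_3) phi p q (k : int) :
  typed tau phi -> tau (phi q) = tau (phi p) + k%:~R ->
  exists m, q.1 - p.1 - (q.2 - p.2) - k = 3 * m.
Proof.
move=> ty e; apply: Z3_int0; rewrite intrB; apply/eqP; rewrite subr_eq0.
by apply/eqP/(addrI (tau (phi p))); rewrite -e (typed_diff p q ty).
Qed.

(** Transposition exchanges the two orientations; with negated types, statements about rows
    therefore apply to columns. *)
Lemma type_map_opp (B : A2_building) (tau : B -> 'Z_3) :
  type_map tau -> type_map (fun x => - tau x).
Proof.
move=> Htau c cC i; have [v [[cv tv] uv]] := Htau c cC (- i).
exists v; split; first by split=> //; rewrite tv opprK.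
by move=> w [cw tw]; apply: uv; split=> //; rewrite -tw opprK.
Qed.

Section Types.
Variables (B : A2_building) (tau : B -> 'Z_3).
Hypothesis Htau : type_map tau.
Implicit Types (A : set (set B)) (phi : int * int -> B) (x y z w : B).

Lemma triangle_chamber x y z : adj x y -> adj y z -> adj x z ->
  chamber [set x; y; z].
Proof.
move=> xy yz xz; split; first exact: adj_simplex3.
move=> s sS sub; apply/seteqP; split=> // u su.
have [A [phi [AA cA As _]]] := apartment_common sS sS.
have xs : s x by apply: sub; left; left.
have ys : s y by apply: sub; left; right.
have zs : s z by apply: sub; right.
have [p pE] := chart_point cA As xs; have [q qE] := chart_point cA As ys.
have [r rE] := chart_point cA As zs; have [v vE] := chart_point cA As su.
subst x y z u; move: xy yz xz => /(chart_adjE _ _ AA cA) pq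
  /(chart_adjE _ _ AA cA) qr /(chart_adjE _ _ AA cA) pr.
have H m : s (phi m) -> m = v \/ plane_adj m v.
  move=> sm; have [->|] := pselect (m = v); first by left.
  by move=> mv; right; apply: (chart_edge cA As).
by case: (plane_clique4 pq qr pr (H _ xs) (H _ ys) (H _ zs)) => [[|]|] ->;
  [left; left|left; right|right].
Qed.

Lemma adj_type x y : adj x y -> tau x <> tau y.
Proof.
move=> xy txy; have [z [xz yz]] := adj_third xy.
have [v [_ uv]] := Htau (triangle_chamber xy yz xz) (tau x).
have vx : v = x by apply: uv; split=> //; left; left.
have vy : v = y by apply: uv; split=> //; left; right.
by apply: xy.1; rewrite -vx -vy.
Qed.

Lemma adj_type1 x y : adj x y -> tau y = tau x + 1 \/ tau x = tau y + 1.
Proof.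
move=> /adj_type xy; have [|e|e] := @Z3_neq0 (tau y - tau x).
- by move/eqP; rewrite subr_eq0 => /eqP /esym.
- by left; rewrite addrC -e subrK.
- by right; rewrite -[LHS](subrK (tau y)) -(opprB (tau y)) e opprK addrC.
Qed.

Lemma adj_type_sum x y z : adj x y -> adj y z -> adj x z ->
  tau x + tau y + tau z = 0.
Proof. by move=> xy yz xz; apply: Z3_sum; exact: adj_type. Qed.

(** The types of a triangle sum to zero. Comparing the two triangles on an edge makes the type
    constant along [e1 + e2]; along [e1] its second differences are multiples of 3. So it is affine
    in [i - j], with slope 1 or -1. *)
Lemma chart_typed A phi : apartment A -> chart A phi ->
  typed tau phi \/ typed tau (fun p => phi (p.2, p.1)).
Proof.
move=> AA cA; pose t i j := tau (phi (i, j)).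
have up i j : t i j + t (i + 1) j + t i (j + 1) = 0.
  by apply: adj_type_sum; apply: (chart_adj AA cA);
    rewrite /plane_adj /plane_dist_le /=; lia.
have dn i j : t (i + 1) j + t i (j + 1) + t (i + 1) (j + 1) = 0.
  by apply: adj_type_sum; apply: (chart_adj AA cA);
    rewrite /plane_adj /plane_dist_le /=; lia.
have diag i j : t (i + 1) (j + 1) = t i j.
  apply: (addrI (t (i + 1) j + t i (j + 1))).
  by rewrite dn [RHS]addrC addrA up.
pose d := t 1 0 - t 0 0.
have step i : t (i + 1) 0 - t i 0 = d.
  have next k : t (k + 1 + 1) 0 - t (k + 1) 0 = t (k + 1) 0 - t k 0.
    have := up (k + 1) 0; rewrite diag => e.
    have -> : t (k + 1 + 1) 0 = - t (k + 1) 0 - t k 0.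
      by apply/eqP; rewrite -subr_eq0 -e; apply/eqP; ring.
    apply/eqP; rewrite -subr_eq0.
    have -> : - t (k + 1) 0 - t k 0 - t (k + 1) 0 - (t (k + 1) 0 - t k 0)
      = - (t (k + 1) 0 *+ 3) by ring.
    by rewrite Z3_three oppr0.
  elim: i => [|n IH|n IH]; first by rewrite add0r.
    by rewrite (_ : n.+1%:Z = n%:Z + 1) ?next//; lia.
  by rewrite -next (_ : - n.+1%:Z + 1 = - n%:Z)//; lia.
have lin i : t i 0 = t 0 0 + i%:~R * d.
  elim: i => [|n IH|n IH]; first by rewrite mul0r addr0.
    have := step n%:Z; rewrite IH => e.
    have -> : n.+1%:Z = n%:Z + 1 by lia.
    by rewrite -[LHS](subrK (t n%:Z 0)) IH e intrD; ring.
  have := step (- n.+1%:Z); rewrite (_ : - n.+1%:Z + 1 = - n%:Z); last by lia.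
  rewrite IH => /eqP; rewrite subr_eq => /eqP e.
  have kE : (- n.+1%:Z)%:~R = (- n%:Z)%:~R - 1 :> 'Z_3.
    by rewrite -[1]/(1%:~R) -intrB; congr _%:~R; lia.
  by apply: (addrI d); rewrite -e kE; ring.
have tE i j : t i j = t (i - j) 0.
  elim: j i => [i|n IH i|n IH i]; first by rewrite subr0.
    have := diag (i - 1) n%:Z; rewrite subrK IH => e.
    by rewrite (_ : n.+1%:Z = n%:Z + 1) ?e; [congr t|]; lia.
  have := diag i (- n.+1%:Z); rewrite (_ : - n.+1%:Z + 1 = - n%:Z); last by lia.
  by rewrite IH => <-; congr t; lia.
have d0 : d <> 0.
  move/eqP; rewrite subr_eq0 => /eqP; apply: adj_type.
  by apply: (chart_adj AA cA); rewrite /plane_adj /plane_dist_le /=; lia.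
case: (Z3_neq0 d0) => dE; [left|right] => -[i j] /=;
  rewrite -!/(t _ _) tE lin dE.
  by rewrite mulr1.
by rewrite -(opprB i j) intrN; ring.
Qed.

(** With the other orientation, the difference of types along the edge would equal its own opposite,
    but it is nonzero modulo 3. *)
Lemma typed_edge A phi phi' p q : apartment A -> chart A phi' ->
  typed tau phi ->
  phi' p = phi p -> phi' q = phi q -> plane_adj p q -> typed tau phi'.
Proof.
move=> AA cA ty pE qE pq.
have [//|ty'] := chart_typed AA cA; exfalso.
have := typed_diff (q.2, q.1) (p.2, p.1) ty'; rewrite /=.
rewrite -!surjective_pairing pE qE => e.
have [m] := typed_Z3 ty e; move: pq.
by case: p q {pE qE e} => a b [c d]; rewrite /plane_adj /plane_dist_le /=; lia.
Qed.

Lemma chart_origin A phi x : chart A phi -> A [set x] ->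
  exists phi', chart A phi' /\ phi' (0, 0) = x.
Proof.
move=> cA Ax; have [p ->] := chart_point cA Ax erefl.
exists (fun u => phi (u.1 + p.1, u.2 + p.2)); split.
  exact: chart_translate.
by rewrite /= !add0r -surjective_pairing.
Qed.

Lemma typed_origin A phi x : apartment A -> chart A phi -> A [set x] ->
  exists phi', [/\ chart A phi', typed tau phi' & phi' (0, 0) = x].
Proof.
move=> AA cA Ax; have [phi' [cA' x0]] := chart_origin cA Ax.
have [ty|ty] := chart_typed AA cA'; first by exists phi'.
by exists (fun p => phi' (p.2, p.1)); split=> //; exact: chart_swap.
Qed.

Lemma link_line b x y : adj b x -> adj b y -> x <> y -> tau x = tau y ->
  exists w, [/\ adj b w, adj x w & adj y w].
Proof.
move=> bx by_ xy txy.
have [A [phi [AA cA Ax Ay]]] := apartment_common bx.2 by_.2.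
wlog ty : phi cA / typed tau phi.
  move=> H; have [ty|ty] := chart_typed AA cA; first exact: H cA ty.
  by apply: H ty; exact: chart_swap.
have [p pE] := chart_point cA Ax (or_introl erefl).
have [q qE] := chart_point cA Ax (or_intror erefl).
have [r rE] := chart_point cA Ay (or_intror erefl).
subst b x y; move: bx by_ => /(chart_adjE _ _ AA cA) pq
  /(chart_adjE _ _ AA cA) pr.
have [m mE] : exists m, r.1 - q.1 - (r.2 - q.2) - 0 = 3 * m.
  by apply: typed_Z3 ty _; rewrite addr0.
have qr : (q.1 != r.1) || (q.2 != r.2).
  rewrite -negb_and; apply/negP => /andP[/eqP e1 /eqP e2]; apply: xy.
  by rewrite (surjective_pairing q) e1 e2 -surjective_pairing.
(* Two neighbours of [p] of equal type are at angle 2 pi / 3, and this is the neighbour of [p]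
   between them. *)
exists (phi (q.1 + r.1 - p.1, q.2 + r.2 - p.2)).
suff [? ? ?] : [/\ plane_adj p (q.1 + r.1 - p.1, q.2 + r.2 - p.2),
   plane_adj q (q.1 + r.1 - p.1, q.2 + r.2 - p.2) &
   plane_adj r (q.1 + r.1 - p.1, q.2 + r.2 - p.2)].
  by split; apply: (chart_adj AA cA).
clear cA ty xy txy Ax Ay.
case: p q r mE qr pq pr => a b [c d] [e f] /= mE qr /plane_adjP /= pq
  /plane_adjP /= pr.
case: pq qr mE => -[] [-> ->]; case: pr => -[] [-> ->] qr mE.
all: split; rewrite /plane_adj /plane_dist_le /=; lia.
Qed.

(** An isomorphism that fixes only two vertices might reverse the orientation. The chart therefore
    passes through an apartment [A3] containing a chamber of [A] at [phi p] and one of [A'] at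
    [phi q], and each of the two isomorphisms fixes a chamber. *)
Lemma transport A A' phi p q : apartment A -> chart A phi -> typed tau phi ->
  apartment A' -> A' [set phi p] -> A' [set phi q] ->
  exists phi', [/\ chart A' phi', typed tau phi', phi' p = phi p &
    phi' q = phi q].
Proof.
move=> AA cA ty AA' A'p A'q.
have [phi1 cA'] := apartment_chart (apartmentP B) AA'.
have tri u : exists v w : int * int, [/\ plane_adj u v, plane_adj v w &
  plane_adj u w].
  exists (u.1 + 1, u.2), (u.1, u.2 + 1).
  by rewrite /plane_adj /plane_dist_le /=; split; lia.
have [v [w [pv vw pw]]] := tri p; pose c := [set phi p; phi v; phi w].
have [q1 q1E] := chart_point cA' A'q erefl.
have [v' [w' [qv vw' qw]]] := tri q1; pose c' := [set phi1 q1; phi1 v';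
  phi1 w'].
have Ac : A c := chart_triangle cA pv vw pw.
have A'c' : A' c' := chart_triangle cA' qv vw' qw.
have [A3 [AA3 A3c A3c']] := apartment_join (apartmentP B)
  (apartment_simplex AA Ac) (apartment_simplex AA' A'c').
have sub1 A1 c1 x : apartment A1 -> A1 c1 -> c1 x -> A1 [set x].
  move=> AA1 A1c x1; have [phi2 cA1] := apartment_chart (apartmentP B) AA1.
  by have [u ->] := chart_point cA1 A1c x1; exact: (chart_vertex _ cA1).
have A3q : A3 [set phi q].
  by apply: sub1 AA3 A3c' _; rewrite q1E; left; left.
have Aq := chart_vertex q cA.
have [phi3 cA3 e3] := chart_transfer AA AA3 cA Ac Aq A3c A3q.
have ty3 : typed tau phi3.
  apply: (typed_edge AA3 cA3 ty _ _ pv); apply: e3; left; left.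
    by left.
  by right.
have e3p : phi3 p = phi p by apply: e3; left; left; left.
have e3q : phi3 q = phi q by apply: e3; right.
have A3p : A3 [set phi3 p] := chart_vertex p cA3.
have A'p3 : A' [set phi3 p] by rewrite e3p.
have [phi' cA'' e'] := chart_transfer AA3 AA' cA3 A3c' A3p A'c' A'p3.
exists phi'; split => //.
- have [u uE] := chart_point cA3 A3c' (or_introl (or_introl erefl)).
  have [u' u'E] := chart_point cA3 A3c' (or_introl (or_intror erefl)).
  apply: (@typed_edge A' phi3 phi' u u') => //.
  + by apply: e'; left; rewrite -uE; left; left.
  + by apply: e'; left; rewrite -u'E; left; right.
  + apply/(chart_adjE _ _ AA3 cA3); rewrite -uE -u'E.
    exact: (chart_adj AA' cA' qv).
- by rewrite e' ?e3p//; right.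
- by rewrite e' ?e3q//; left; left; left; rewrite q1E.
Qed.

End Types.

Lemma typed_swap (B : A2_building) (tau : B -> 'Z_3) phi :
  typed tau phi -> typed (fun x => - tau x) (fun p => phi (p.2, p.1)).
Proof.
move=> ty [i j] /=; rewrite (ty (j, i)) /= opprD -intrN; congr (_ + _%:~R); lia.
Qed.

(** * Uniqueness of predecessors towards an origin *)

Section Hull.
Variables (B : A2_building) (tau : B -> 'Z_3).
Hypothesis Htau : type_map tau.
Implicit Types (A : set (set B)) (phi : int * int -> B) (x y z : B).

(** The neighbours of [(m.+1, n)] of the preceding type are [(m, n)], [(m.+2, n - 1)] and
    [(m.+1, n.+1)]. Only the first is within distance [m + n] of the origin. *)
Let pred_position A phi (m n : nat) p y : apartment A -> chart A phi ->
  typed tau phi -> y = phi p -> adj y (phi (m.+1%:Z, n%:Z)) ->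
  tau (phi (m.+1%:Z, n%:Z)) = tau y + 1 -> reach (phi (0, 0)) (m + n) y ->
  p = (m%:Z, n%:Z).
Proof.
move=> AA cA ty -> /(chart_adjE _ _ AA cA) pq tE.
have [rho [rK rho_adj]] := chart_retraction AA cA.
move/(reach_plane rho_adj); rewrite !rK => d.
have [k kE] : exists k, m.+1%:Z - p.1 - (n%:Z - p.2) - 1 = 3 * k.
  exact: (typed_Z3 (k := 1) ty tE).
case: p pq d kE {tE} => a b.
rewrite /plane_adj /plane_dist_le /= => h1 h2 h3; congr pair; lia.
Qed.

(* Let [b := phi (m.+1, n)]. If [y] differs from [y0 := phi (m, n)], then the
   link of [b] contains a common neighbour [w] of both; the retraction centred
   at [{b, y0, w}] onto an apartment through the origin maps [y] to the mirror
   image of [y0] in the wall through [b] and [w], which is too far from the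
   origin. *)
Lemma pred_unique A phi (m n : nat) y : apartment A -> chart A phi ->
  typed tau phi -> adj y (phi (m.+1%:Z, n%:Z)) ->
  tau (phi (m.+1%:Z, n%:Z)) = tau y + 1 -> reach (phi (0, 0)) (m + n) y ->
  y = phi (m%:Z, n%:Z).
Proof.
move=> AA cA ty yb tb ry; apply: contrapT => yy0.
set b := phi _ in yb tb; set y0 := phi _ in yy0.
have y0b : adj y0 b.
  by apply: (chart_adj AA cA); rewrite /plane_adj /plane_dist_le /=; lia.
have ty0 : tau b = tau y0 + 1.
  rewrite /b /y0 (typed_diff (m%:Z, n%:Z) _ ty) /= -[1]/(1%:~R); congr (_
    + _%:~R); lia.
have ry0 : reach (phi (0, 0)) (m + n) y0.
  rewrite /y0; elim: (m) => [|k IH].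
    elim: (n) => [|k IH]; first exact: reach0.
    apply: (reachS IH); apply: (chart_adj AA cA).
    by rewrite /plane_adj /plane_dist_le /=; lia.
  apply: (reachS IH); apply: (chart_adj AA cA).
  by rewrite /plane_adj /plane_dist_le /=; lia.
have [w [bw yw y0w]] : exists w, [/\ adj b w, adj y w & adj y0 w].
  apply: (link_line Htau) => //; try exact: adj_sym.
  by apply: (addIr 1); rewrite -tb -ty0.
have S := adj_simplex3 (adj_sym y0b) y0w bw.
have [A2 [_ [AA2 _ A2S A2a]]] :=
  apartment_common S (@simplex_vertex B (phi (0, 0))).
have sub x : [set b; y0; w] x -> A2 [set x].
  have [phi1 cA1] := apartment_chart (apartmentP B) AA2.
  by move=> xS; have [u ->] := chart_point cA1 A2S xS;
    exact: (chart_vertex _ cA1).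
have A2b : A2 [set phi (m.+1%:Z, n%:Z)] by apply: sub; left; left.
have [phi2 [cA2 ty2 a2 b2]] := transport Htau AA cA ty AA2 A2a A2b.
have [p pE] := chart_point cA2 A2S (or_introl (or_intror erefl)).
have [r rE] := chart_point cA2 A2S (or_intror erefl).
have {}pE : y0 = phi2 (m%:Z, n%:Z).
  rewrite pE; congr phi2; apply: (pred_position AA2 cA2 ty2 pE);
    rewrite ?b2 ?a2 //.
have bq : plane_adj (m.+1%:Z, n%:Z) (m%:Z, n%:Z).
  by rewrite /plane_adj /plane_dist_le /=; lia.
have bwr : plane_adj (m.+1%:Z, n%:Z) r.
  by apply/(chart_adjE _ _ AA2 cA2); rewrite b2 -rE.
have ywr : plane_adj (m%:Z, n%:Z) r.
  by apply/(chart_adjE _ _ AA2 cA2); rewrite -pE -rE.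
have [rho [rK rho_adj rho_c]] := retraction AA2 cA2 bq ywr bwr.
have ne : rho y <> (m%:Z, n%:Z).
  by move=> e; apply: yy0; rewrite -(rho_c y) ?e -?pE //; left; right.
have := rho_adj _ _ yb; have := rho_adj _ _ yw; have := reach_plane rho_adj ry.
rewrite -a2 /b -b2 rE !rK.
have {}ne : ((rho y).1 != m%:Z) || ((rho y).2 != n%:Z).
  rewrite -negb_and; apply/negP => /andP[/eqP e1 /eqP e2]; apply: ne.
  by rewrite (surjective_pairing (rho y)) e1 e2.
move: ne bwr ywr; move: (rho y) r {rE rho_c} => [u1 u2] [r1 r2] ne.
move=> /plane_adjP /= [] [] [-> ->]; move: ne.
all: rewrite /plane_adj /plane_dist_le /=; lia.
Qed.

End Hull.

(** * Flat maps *)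

(** Straightness is expressed by non-adjacency: in the link of [k i.+1 j], the vertices [k i j] and
    [k i.+2 j] are a point and a line, which are opposite as soon as they are not incident. *)
Record flat (B : A2_building) (tau : B -> 'Z_3) (k : nat -> nat -> B) : Prop :=
  Flat {
  flat_type : forall i j, tau (k i j) = tau (k 0 0) + (i%:Z - j%:Z)%:~R;
  flat_e1 : forall i j, adj (k i j) (k i.+1 j);
  flat_e2 : forall i j, adj (k i j) (k i j.+1);
  flat_e3 : forall i j, adj (k i.+1 j) (k i j.+1);
  flat_s1 : forall i j, ~ adj (k i j) (k i.+2 j);
  flat_s2 : forall i j, ~ adj (k i j) (k i j.+2) }.

Lemma flat_tr (B : A2_building) (tau : B -> 'Z_3) k :
  flat tau k -> flat (fun x => - tau x) (fun i j => k j i).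
Proof.
case=> ty e1 e2 e3 s1 s2; split=> //; last by move=> i j; exact: adj_sym.
by move=> i j; rewrite ty opprD -intrN; congr (_ + _%:~R); lia.
Qed.

Lemma flat_tr_opp (B : A2_building) (tau : B -> 'Z_3) k :
  flat (fun x => - tau x) k -> flat tau (fun i j => k j i).
Proof.
move/flat_tr; suff -> : (fun x => - - tau x) = tau by [].
by apply/funext => x; rewrite opprK.
Qed.

Lemma flat_reach (B : A2_building) (tau : B -> 'Z_3) k i j :
  flat tau k -> reach (k 0 0) (i + j) (k i j).
Proof.
move=> kf; elim: i => [|i IH]; last exact: reachS IH (flat_e1 kf i j).
elim: j => [|j IH]; first exact: reach0.
exact: reachS IH (flat_e2 kf 0 j).
Qed.

(** Descending induction from the corner [(m, n)]: [k i j] precedes [k i.+1 j] or [k i j.+1] on a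
    path from the origin, so [pred_unique] locates it, in the second case after transposition. *)
Lemma flat_hull (B : A2_building) (tau : B ->
  'Z_3) k (A : set (set B)) phi m n :
  type_map tau -> flat tau k -> apartment A -> chart A phi -> typed tau phi ->
  phi (0, 0) = k 0 0 -> phi (m%:Z, n%:Z) = k m n ->
  forall i j, (i <= m)%N -> (j <= n)%N -> phi (i%:Z, j%:Z) = k i j.
Proof.
move=> Htau kf AA cA ty e0 emn.
suff H d i j : (i <= m)%N -> (j <= n)%N -> (m - i + (n - j) = d)%N ->
    phi (i%:Z, j%:Z) = k i j by move=> i j im jn; exact: H im jn erefl.
elim: d i j => [|d IH] i j im jn dE.
  by have [-> ->] : i = m /\ j = n by lia.
have step1 : k i.+1 j = phi (i.+1%:Z, j%:Z) -> k i j = phi (i%:Z, j%:Z).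
  move=> e; apply: (pred_unique Htau AA cA ty); rewrite -?e.
  - exact: flat_e1 kf i j.
  - by rewrite (flat_type kf i) (flat_type kf i.+1) -addrA -[1]/(1%:~R) -intrD;
      congr (_ + _%:~R); lia.
  - by rewrite e0; exact: flat_reach kf.
have step2 : k i j.+1 = phi (i%:Z, j.+1%:Z) -> k i j = phi (i%:Z, j%:Z).
  move=> e; have kf' := flat_tr kf.
  apply: (pred_unique (type_map_opp Htau) AA (chart_swap cA) (typed_swap ty));
    rewrite /= -?e.
  - exact: flat_e1 kf' j i.
  - by rewrite (flat_type kf i j) (flat_type kf i j.+1) !opprD -addrA
    -[1]/(1%:~R) -!intrN -intrD;
      congr (_ + _%:~R); lia.
  - by rewrite e0; exact: flat_reach kf'.
have [im'|im'] := ltnP i m.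
  by rewrite step1 // IH //; lia.
by rewrite step2 // IH //; lia.
Qed.

(** The axis of [e1] is a wall, so this reflection preserves types, unlike the swap of
    coordinates. *)
Lemma typed_reflect (B : A2_building) (tau : B -> 'Z_3) phi :
  typed tau phi -> typed tau (fun p => phi (p.1 + p.2, - p.2)).
Proof.
move=> ty [i j]; rewrite (ty (i + j, - j)) /= -[(0 + 0, - 0)]/(0, 0).
rewrite (_ : i + j - - j = i - j + j * 3); last by lia.
by rewrite intrD intrM mulr_natr Z3_three addr0.
Qed.

Lemma typed_rotate (B : A2_building) (tau : B -> 'Z_3) phi :
  typed tau phi -> typed tau (fun p => phi (- p.1 - p.2, p.1)).
Proof.
move=> ty [i j]; rewrite (ty (- i - j, i)) /= -[(- 0 - 0, 0)]/(0, 0).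
rewrite (_ : - i - j - i = i - j + (- i) * 3); last by lia.
by rewrite intrD intrM mulr_natr Z3_three addr0.
Qed.

Lemma plane_adj_succ p r (l : int) : plane_adj p r ->
  r.1 - p.1 - (r.2 - p.2) - 1 = 3 * l ->
  [\/ r = (p.1 + 1, p.2), r = (p.1 - 1, p.2 + 1) | r = (p.1, p.2 - 1)].
Proof.
case/plane_adjP=> -[] -> /= lE.
all: by [constructor 1|constructor 2|constructor 3|lia].
Qed.

Lemma plane_adj_pred p r (l : int) : plane_adj p r ->
  r.1 - p.1 - (r.2 - p.2) - (-1) = 3 * l ->
  [\/ r = (p.1, p.2 + 1), r = (p.1 - 1, p.2) | r = (p.1 + 1, p.2 - 1)].
Proof.
case/plane_adjP=> -[] -> /= lE.
all: by [constructor 1|constructor 2|constructor 3|lia].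
Qed.

(** * Rectangles of flat maps in apartments *)

Section FlatRectangles.
Variables (B : A2_building) (tau : B -> 'Z_3) (k : nat -> nat -> B).
Hypotheses (Htau : type_map tau) (kf : flat tau k).

Let rect m n := exists A phi, [/\ apartment A, chart A phi, typed tau phi,
  phi (0, 0) = k 0 0 & phi (m%:Z, n%:Z) = k m n].

(** Some apartment contains the new edge and the origin; [transport] gives it a chart in which the
    two old corners keep their coordinates. *)
Let rect_next m n x : rect m n -> adj (k m n) x -> exists A phi r,
  [/\ apartment A, chart A phi, typed tau phi, phi (0, 0) = k 0 0 &
    [/\ phi (m%:Z, n%:Z) = k m n, x = phi r & plane_adj (m%:Z, n%:Z) r]].
Proof.
move=> [A [phi [AA cA ty e0 emn]]] xk.
have [A' [phi1 [AA' cA1 A'x A'0]]] :=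
  apartment_common xk.2 (@simplex_vertex B (k 0 0)).
have A'k : A' [set k m n].
  have [u ->] := chart_point cA1 A'x (or_introl erefl).
  exact: (chart_vertex _ cA1).
rewrite -e0 in A'0; rewrite -emn in A'k.
have [phi' [cA' ty' e0' emn']] := transport Htau AA cA ty AA' A'0 A'k.
have [r rE] := chart_point cA' A'x (or_intror erefl).
exists A', phi', r; split=> //; first by rewrite e0'.
split=> //; first by rewrite emn'.
by apply/(chart_adjE _ _ AA' cA'); rewrite -rE emn' emn.
Qed.

Let hull_at m n (A : set (set B)) phi := @flat_hull B tau k A phi m n Htau kf.

Let rect00 : rect 0 0.
Proof.
have [A [phi [AA cA A0 _]]] := apartment_common (@simplex_vertex B (k 0 0))
  (@simplex_vertex B (k 0 0)).
have [phi' [cA' ty' e0]] := typed_origin Htau AA cA A0.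
by exists A, phi'.
Qed.

Let dir1 m n (phi : int * int -> B) r : typed tau phi ->
  phi (m%:Z, n%:Z) = k m n -> k m.+1 n = phi r ->
  exists l, r.1 - m%:Z - (r.2 - n%:Z) - 1 = 3 * l.
Proof.
move=> ty e rE; apply: (typed_Z3 (p := (m%:Z, n%:Z)) (q := r) (k := 1) ty).
rewrite e -rE (flat_type kf m n) (flat_type kf m.+1 n) -addrA -intrD.
by congr (_ + _%:~R); lia.
Qed.

Let dir2 m n (phi : int * int -> B) r : typed tau phi ->
  phi (m%:Z, n%:Z) = k m n -> k m n.+1 = phi r ->
  exists l, r.1 - m%:Z - (r.2 - n%:Z) - (-1) = 3 * l.
Proof.
move=> ty e rE; apply: (typed_Z3 (p := (m%:Z, n%:Z)) (q := r) (k := -1) ty).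
rewrite e -rE (flat_type kf m n) (flat_type kf m n.+1) -addrA -intrD.
by congr (_ + _%:~R); lia.
Qed.

Let rect_row m : rect m 0.
Proof.
elim: m => [//|m IH].
have [A [phi [r [AA cA ty e0 [em rE]]]]] := rect_next IH (flat_e1 kf m 0).
have [l lE] := dir1 ty em rE.
(* The first edge is not constrained by straightness: the rotations about the origin account for its
   three possible positions. *)
case: m IH em lE rE => [|m] IH em lE rE mr.
  case: (plane_adj_succ mr lE) => re; rewrite {}re in rE.
  - by exists A, phi.
  - exists A, (fun p => phi (- p.1 - p.2, p.1)); split=> //.
    + exact: chart_rotate.
    + exact: typed_rotate.
  - exists A, (fun p => phi (- (- p.1 - p.2) - p.1, - p.1 - p.2)); split=> //.
    + exact: (chart_rotate (chart_rotate cA)).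
    + exact: (typed_rotate (typed_rotate ty)).
suff re : r = (m.+2%:Z, 0) by exists A, phi; rewrite -re.
(* The other two candidates for [r] are adjacent to [(m, 0)]. *)
have nr : ~~ plane_adj (m%:Z, 0) r.
  apply/negP => /(chart_adj AA cA); rewrite -rE.
  rewrite (hull_at AA cA ty e0 em (i := m) (j := 0)) //.
  exact: (flat_s1 kf).
case: (plane_adj_succ mr lE) nr => ->.
all: by rewrite /plane_adj /plane_dist_le /= => ?; congr pair; lia.
Qed.

Lemma flat_rect m n : exists A phi, [/\ apartment A, chart A phi,
  typed tau phi, phi (0, 0) = k 0 0 & phi (m%:Z, n%:Z) = k m n].
Proof.
elim: n => [|n IH]; first exact: rect_row.
have [A [phi [r [AA cA ty e0 [em rE]]]]] := rect_next IH (flat_e2 kf m n).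
have [l lE] := dir2 ty em rE => mr.
have hull := hull_at AA cA ty e0 em.
case: n IH em hull lE rE mr => [|n] IH em hull lE rE mr.
  case: m IH em hull lE rE mr => [|m] IH em hull lE rE mr.
    case: (plane_adj_pred mr lE) => re; rewrite {}re in rE.
    - by exists A, phi.
    - exists A, (fun p => phi (- p.1 - p.2, p.1)); split=> //.
      + exact: chart_rotate.
      + exact: typed_rotate.
    - exists A, (fun p => phi (- (- p.1 - p.2) - p.1, - p.1 - p.2)); split=> //.
      + exact: (chart_rotate (chart_rotate cA)).
      + exact: (typed_rotate (typed_rotate ty)).
  (* Otherwise [k m.+1 1 = k m 0] would be adjacent to [k m.+2 0], against the straightness of row
     0. *)
  have rm : r <> (m%:Z, 0).
    move=> e; rewrite e (hull m 0)// in rE.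
    have s1 := @flat_s1 _ _ _ kf m 0; apply: s1; rewrite -rE; apply: adj_sym.
    exact: flat_e3 kf m.+1 0%N.
  have : r = (m.+1%:Z, 1) \/ r = (m.+2%:Z, -1).
    case: (plane_adj_pred mr lE) => /= re; rewrite {}re in rm *.
    - by left; congr pair; lia.
    - by exfalso; apply: rm; congr pair; lia.
    - by right; congr pair; lia.
  case=> re; rewrite {}re in rE; first by exists A, phi.
  (* Here [r] is on the wrong side of row 0; the reflection in the axis of [e1] fixes that row and
     corrects this. *)
  exists A, (fun p => phi (p.1 + p.2, - p.2)); split=> //.
  - exact: chart_reflect.
  - exact: typed_reflect.
  - by rewrite rE /=; congr phi; congr pair; lia.
suff re : r = (m%:Z, n.+2%:Z) by exists A, phi; rewrite -re.
have nr : ~~ plane_adj (m%:Z, n%:Z) r.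
  apply/negP => /(chart_adj AA cA); rewrite -rE (hull m n)//.
  exact: (flat_s2 kf).
case: (plane_adj_pred mr lE) nr => ->.
all: by rewrite /plane_adj /plane_dist_le /= => ?; congr pair; lia.
Qed.

End FlatRectangles.

Lemma Z3_succ_third (x y z : 'Z_3) :
  x + y + z = 0 -> y = x + 1 -> x = z + 1.
Proof.
move=> s e; apply/eqP; rewrite -subr_eq0.
have -> : x - (z + 1) = x *+ 3 - (x + y + z) + (y - (x + 1)) by ring.
by rewrite s e Z3_three !subrr addr0.
Qed.

(** * Prolonging a flat map by a column *)

Section FlatExtension.
Variables (B : A2_building) (tau : B -> 'Z_3) (k : nat -> nat -> B).
Hypotheses (Htau : type_map tau) (kf : flat tau k).

Let skew i j : k i j <> k i.+1 j.+1.
Proof.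
move=> e; have s2 := @flat_s2 _ _ _ kf i j; apply: s2.
by rewrite e; exact: (flat_e3 kf).
Qed.

(* [c] can be put before [k 0 j] in row [j]. *)
Let side (j : nat) (c : B) :=
  [/\ adj c (k 0 j), tau (k 0 j) = tau c + 1 & ~ adj c (k 1 j)].

Let side_neq j c : side j c -> c <> k 0 j.+1.
Proof.
by case=> _ _ c1 e; apply: c1; rewrite e; exact/adj_sym/(flat_e3 kf).
Qed.

(** In the link of [k 0 j], the vertices [c] and [k 0 j.+1] have the same type, and [w] is the line
    joining them. Were [w] adjacent to [k 1 j.+1], it would be [k 1 j] by [link_uniq], against
    [side j c]. *)
Let side_next j c : side j c ->
  exists w, [/\ side j.+1 w, adj c w & adj (k 0 j) w].
Proof.
move=> cs; have cn := side_neq cs; case: cs => ck tk c1.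
have tk' : tau (k 0 j) = tau (k 0 j.+1) + 1.
  rewrite (flat_type kf 0 j) (flat_type kf 0 j.+1) -addrA -[1]/(1%:~R) -intrD.
  by congr (_ + _%:~R); lia.
have [w [kw cw k'w]] : exists w, [/\ adj (k 0 j) w, adj c w & adj (k 0 j.+1) w].
  apply: (link_line Htau) => //; first exact: adj_sym.
    exact: (flat_e2 kf).
  by apply: (addIr 1); rewrite -tk -tk'.
exists w; split=> //; split; first exact: adj_sym.
  have s : tau c + tau (k 0 j) + tau w = 0.
    exact: (adj_type_sum Htau).
  rewrite -(Z3_succ_third s tk).
  by apply: (addIr 1); rewrite -tk' tk.
move=> wk; apply: c1; suff <- : w = k 1 j by [].
apply: (@link_uniq _ (k 0 j.+1) (k 0 j) (k 1 j.+1)) => //.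
- exact/adj_sym/(flat_e2 kf).
- exact: (flat_e1 kf).
- exact/adj_sym/(flat_e3 kf).
- exact: adj_sym.
- exact: (flat_e1 kf).
- exact/adj_sym/(flat_e2 kf).
Qed.

Lemma flat_ext x : adj x (k 0 0) -> tau (k 0 0) = tau x + 1 ->
  ~ adj x (k 1 0) ->
  exists k', [/\ flat tau k', k' 0 0 = x & forall i j, k' i.+1 j = k i j].
Proof.
move=> xk tx x1.
(* [F] takes an arbitrary value where [side] fails; the column [c] built from it never meets this
   case. *)
have /choice[F FP] : forall p : nat * B, exists w, side p.1 p.2 ->
    [/\ side p.1.+1 w, adj p.2 w & adj (k 0 p.1) w].
  move=> p; have [s|s] := pselect (side p.1 p.2).
    by have [w wP] := side_next s; exists w.
  by exists (k 0 0).
pose c := fix c j := if j is i.+1 then F (i, c i) else x.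
have cs j : side j (c j).
  by elim: j => [|j IH] //; have [] := FP (j, c j) IH.
have cc j : adj (c j) (c j.+1) by have [] := FP (j, c j) (cs j).
have kc j : adj (k 0 j) (c j.+1) by have [] := FP (j, c j) (cs j).
exists (fun i j => if i is i'.+1 then k i' j else c j); split=> //.
have k0E : tau (k 0 0) = tau x + 1 by [].
split.
- case=> [|i] j.
    have [_ e _] := cs j; apply: (addIr 1); rewrite -e (flat_type kf 0 j) k0E.
    by rewrite [RHS]addrAC.
  rewrite (flat_type kf i j) k0E -addrA -[1]/(1%:~R) -intrD.
  by congr (_ + _%:~R); lia.
- case=> [|i] j; first by have [] := cs j.
  exact: (flat_e1 kf).
- by case=> [|i] j; [exact: cc|exact: (flat_e2 kf)].
- by case=> [|i] j; [exact: kc|exact: (flat_e3 kf)].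
- case=> [|i] j; first by have [] := cs j.
  exact: (flat_s1 kf).
- case=> [|i] j; last exact: (flat_s2 kf).
  (* If the new column were bent, [c j.+2] and [k 0 j] would both join [c j] and [k 0 j.+1] in the
     link of [c j.+1], hence coincide, and column 0 of [k] would be bent too. *)
  move=> c2; have e : c j.+2 = k 0 j.
    apply: (@link_uniq _ (c j.+1) (c j) (k 0 j.+1)) => //.
    + exact/adj_sym/cc.
    + by have [] := cs j.+1.
    + exact/adj_sym/kc.
    + by have [] := cs j.
    + exact/adj_sym/(flat_e2 kf).
    + exact: side_neq (cs j).
  have s2 := @flat_s2 _ _ _ kf 0 j; apply: s2.
  by rewrite -e; have [] := cs j.+2.
Qed.

Lemma flat_opposite : exists x,
  [/\ adj x (k 0 0), tau (k 0 0) = tau x + 1 & ~ adj x (k 1 0)].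
Proof.
have kk : adj (k 0 0) (k 1 0) := flat_e1 kf 0 0.
have [A [phi [AA cA A1 _]]] := apartment_common kk.2 kk.2.
wlog ty : phi cA / typed tau phi.
  move=> H; have [ty|ty] := chart_typed Htau AA cA; first exact: H cA ty.
  by apply: H ty; exact: chart_swap.
have [p pE] := chart_point cA A1 (or_introl erefl).
have [q qE] := chart_point cA A1 (or_intror erefl).
have pq : plane_adj p q by apply/(chart_adjE _ _ AA cA); rewrite -pE -qE.
(* The point symmetric to [q] about [p]. *)
exists (phi (p.1 + p.1 - q.1, p.2 + p.2 - q.2)); split.
- rewrite pE; apply: (chart_adj AA cA).
  by move: pq; rewrite /plane_adj /plane_dist_le /=; lia.
- rewrite pE (typed_diff q p ty) -qE (flat_type kf 1 0).
  rewrite [in RHS](typed_diff q _ ty) -qE (flat_type kf 1 0) /= -!addrA.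
  rewrite -[X in _ = _ + (_ + (_ + X))]/(1%:~R) -!intrD.
  have [m mE] : exists m, q.1 - p.1 - (q.2 - p.2) - 1 = 3 * m.
    apply: (typed_Z3 (k := 1) ty).
    by rewrite -qE -pE (flat_type kf 1 0).
  congr (_ + _); apply/eqP; rewrite -subr_eq0 -intrB; apply/eqP.
  set z := (_ - _ : int); have -> : z = m * 3 by rewrite /z; lia.
  by rewrite intrM mulr_natr Z3_three.
- rewrite qE => /(chart_adjE _ _ AA cA).
  by move: pq; rewrite /plane_adj /plane_dist_le /=; lia.
Qed.

Lemma flat_extend : exists2 k', flat tau k' & forall i j, k' i.+1 j = k i j.
Proof.
have [x [xk tx x1]] := flat_opposite.
by have [k' [? _ ?]] := flat_ext xk tx x1; exists k'.
Qed.

End FlatExtension.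

Lemma flat_extend2 (B : A2_building) (tau : B -> 'Z_3) k : type_map tau ->
  flat tau k ->
  exists2 k', flat tau k' & forall i j, k' i.+1 j.+1 = k i j.
Proof.
move=> Htau kf; have [k1 k1f k1E] := flat_extend Htau kf.
have [k2 k2f k2E] := flat_extend (type_map_opp Htau) (flat_tr k1f).
exists (fun i j => k2 j i); first exact: flat_tr_opp.
by move=> i j; rewrite k2E k1E.
Qed.

Definition in_box (n : nat) (p : int * int) : bool :=
  [&& - n%:Z <= p.1, p.1 <= n%:Z, - n%:Z <= p.2 & p.2 <= n%:Z].

Lemma in_boxW m n p : (m <= n)%N -> in_box m p -> in_box n p.
Proof. by rewrite /in_box; lia. Qed.

Lemma plane_simplex_box s : plane_simplex s ->
  exists n, forall p, s p -> in_box n p.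
Proof.
move=> sP; have [p sp] := sP.1; exists (absz p.1 + absz p.2).+1 => q sq.
have [<-|] := plane_simplex_adj sP sp sq; first by rewrite /in_box; lia.
by rewrite /plane_adj /plane_dist_le /in_box; lia.
Qed.

(** * Limits of apartments *)

Section Limits.
Variable B : A2_building.
Implicit Types (A : set (set B)) (phi : int * int -> B).

Definition limit_of_charts phi := forall n, exists A phi',
  [/\ apartment A, chart A phi' & forall p, in_box n p -> phi' p = phi p].

Let img phi := [set phi @` s | s in plane_simplex].

Let limit_injective phi : limit_of_charts phi -> injective phi.
Proof.
move=> lim p q.
have [A [phi' [_ cA e]]] := lim (absz p.1 + absz p.2 + absz q.1 + absz q.2)%N.
rewrite -!e; first exact: cA.1.
all: by rewrite /in_box; lia.
Qed.

Let chart_limit A phi : apartment A -> chart A phi -> limit_of_charts phi.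
Proof. by move=> AA cA n; exists A, phi. Qed.

Let eq_image_box n phi phi' (s : set (int * int)) :
  (forall p, in_box n p -> phi' p = phi p) -> (forall p, s p -> in_box n p) ->
  phi' @` s = phi @` s.
Proof.
move=> e sn; apply/seteqP; split=> _ [p sp <-]; exists p => //.
all: by rewrite e//; exact: sn.
Qed.

Let image_inj phi (s t : set (int * int)) : injective phi ->
  phi @` s = phi @` t -> s = t.
Proof.
move=> phi_inj e; apply/seteqP; split=> p sp.
  by have [q tq /phi_inj <-] : (phi @` t) (phi p) by rewrite -e; exists p.
by have [q tq /phi_inj <-] : (phi @` s) (phi p) by rewrite e; exists p.
Qed.

(** On a box large enough for [s] and [t], the limits agree with charts [f] and [f']. Read in
    coordinates, an isomorphism between the apartments of these is a symmetry [g] of the tiling, and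
    [g] also carries the one limit to the other. *)
Let limit_iso phi phi' s t : limit_of_charts phi -> limit_of_charts phi' ->
  img phi s -> img phi t -> img phi' s -> img phi' t ->
  exists2 psi, subcomplex_iso (img phi) (img phi') psi &
    forall x, (s `|` t) x -> psi x = x.
Proof.
move=> lim lim' [s1 s1P s1E] [t1 t1P t1E] [s2 s2P s2E] [t2 t2P t2E].
have [a a1] := plane_simplex_box s1P; have [b b1] := plane_simplex_box t1P.
have [c c1] := plane_simplex_box s2P; have [d d1] := plane_simplex_box t2P.
pose n := (a + b + c + d)%N.
have {}a1 p : s1 p -> in_box n p by move=> /a1; apply: in_boxW; rewrite /n; lia.
have {}b1 p : t1 p -> in_box n p by move=> /b1; apply: in_boxW; rewrite /n; lia.
have {}c1 p : s2 p -> in_box n p by move=> /c1; apply: in_boxW; rewrite /n; lia.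
have {}d1 p : t2 p -> in_box n p by move=> /d1; apply: in_boxW; rewrite /n; lia.
have [A [f [AA cA fE]]] := lim n; have [A' [f' [AA' cA' fE']]] := lim' n.
have As : A s.
  by apply/(chart_mem _ cA); exists s1; rewrite // (eq_image_box fE a1) s1E.
have At : A t.
  by apply/(chart_mem _ cA); exists t1; rewrite // (eq_image_box fE b1) t1E.
have A's : A' s.
  by apply/(chart_mem _ cA'); exists s2; rewrite // (eq_image_box fE' c1) s2E.
have A't : A' t.
  by apply/(chart_mem _ cA'); exists t2; rewrite // (eq_image_box fE' d1) t2E.
have [h chA' hE] := chart_transfer AA AA' cA As At A's A't.
have [g [gE _ _]] := chart_affine AA' chA' cA'.
have g_inj : injective g by move=> p q e; apply: chA'.1; rewrite -!gE e.
have g_img : [set g @` u | u in plane_simplex] = plane_simplex.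
  have fgE u : f' @` (g @` u) = h @` u.
    by rewrite image_comp; apply: eq_imagel => p _ /=; rewrite gE.
  apply/seteqP; split=> [_ [u uP <-]|u uP].
    have : A' (h @` u) by apply/(chart_mem _ chA'); exists u.
    rewrite -fgE => /(chart_mem _ cA')[v vP /(image_inj cA'.1) ->] //.
  have : A' (f' @` u) by apply/(chart_mem _ cA'); exists u.
  move=> /(chart_mem _ chA')[v vP]; rewrite -fgE => /(image_inj cA'.1) ->.
  by exists v.
have phi_inj := limit_injective lim; have phi'_inj := limit_injective lim'.
have /choice[inv invE] : forall x, exists p, (exists q, x = phi q) -> x = phi p.
  move=> x; have [[q ->]|H] := pselect (exists q, x = phi q); first by exists q.
  by exists (0, 0).
have invK p : inv (phi p) = p.
  by apply: phi_inj; rewrite -invE//; exists p.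
exists (fun x => phi' (g (inv x))).
  split.
    move=> x y; rewrite !inE => -[_ [u _ <-] [p _ <-]] [_ [v _ <-] [q _ <-]].
    by rewrite !invK => /phi'_inj/g_inj ->.
  rewrite /img -[in RHS]g_img !image_comp; apply: eq_imagel => u _ /=.
  rewrite !image_comp; apply: eq_imagel => p _ /=; by rewrite invK.
have fixed x (r : set B) r1 r2 : r x -> r = phi @` r1 -> r = phi' @` r2 ->
    (forall p, r1 p -> in_box n p) -> (forall p, r2 p -> in_box n p) ->
    (forall p, r (f p) -> h p = f p) -> phi' (g (inv x)) = x.
  move=> rx r1E r2E b1' b2 hf.
  have := rx; rewrite r1E => -[p r1p pE].
  have := rx; rewrite r2E => -[q r2q qE].
  have fp : f p = x by rewrite fE ?pE//; exact: b1'.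
  have f'q : f' q = x by rewrite fE' ?qE//; exact: b2.
  have -> : inv x = p by rewrite -(invK p) pE.
  by rewrite -[RHS]qE; congr phi'; apply: cA'.1; rewrite gE f'q hf ?fp.
move=> x [sx|tx] /=.
  apply: (fixed x s s1 s2 sx (esym s1E) (esym s2E) a1 c1) => p sp.
  by apply: hE; left.
apply: (fixed x t t1 t2 tx (esym t1E) (esym t2E) b1 d1) => p tp.
by apply: hE; right.
Qed.

(* The limits of charts form an apartment system, as the isomorphisms fixing two
   simplices only have to be compared on a large box. *)
Lemma limit_chart phi : limit_of_charts phi ->
  exists2 A, apartment A & chart A phi.
Proof.
move=> lim; exists (img phi); last by split=> //; exact: limit_injective.
pose AA := [set S | exists2 phi, limit_of_charts phi & S = img phi].
suff : apartment_system AA by move/apartment_complete; apply; exists phi.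
split.
- move=> _ [f lf ->] _ [s sP <-]; have [n sn] := plane_simplex_box sP.
  have [A [f' [AA' cA e]]] := lf n; apply: (apartment_simplex AA').
  by apply/(chart_mem _ cA); exists s => //; rewrite (eq_image_box e sn).
- by move=> _ [f lf ->]; exists f; split=> //; exact: limit_injective.
- move=> s t sS tS; have [A [f [AA' cA As At]]] := apartment_common sS tS.
  exists A; split=> //; exists f; first exact: chart_limit cA.
  by rewrite /img cA.2.
- by move=> _ _ s t [f lf ->] [f' lf' ->]; exact: limit_iso.
Qed.

End Limits.

(** Repeated prolongation extends [k] to the plane. Every box of the result is a rectangle of a flat
    map, hence lies in an apartment, so the result is a limit of charts. *)
Lemma flat_apartment (B : A2_building) (tau : B -> 'Z_3) k : type_map tau ->
  flat tau k -> exists A phi, [/\ apartment A, chart A phi, typed tau phi &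
    forall i j : nat, phi (i%:Z, j%:Z) = k i j].
Proof.
move=> Htau kf; pose T := {k | flat tau k}.
have /choice[next nextE] : forall k : T, exists k' : T,
    forall i j, sval k' i.+1 j.+1 = sval k i j.
  case=> k1 k1f; have [k2 k2f e] := flat_extend2 Htau k1f.
  by exists (exist _ k2 k2f).
(* [K n] has [n] more columns and rows than [k], so its index [(i + n, j + n)] stands for the point
   [(i, j)]; [m p] steps are enough to reach the point [p]. *)
pose K n := sval (iter n next (exist _ k kf)).
have Kf n : flat tau (K n) := svalP _.
have KS n d i j : K (n + d)%N (i + d)%N (j + d)%N = K n i j.
  elim: d => [|d IH]; first by rewrite !addn0.
  by rewrite -IH !addnS /K /= nextE.
pose m (p : int * int) := (absz p.1 + absz p.2)%N.
pose phi (p : int * int) := K (m p) (absz (p.1 + m p)) (absz (p.2 + m p)).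
have phiE n p : quadrant n p -> phi p = K n (absz (p.1 + n)) (absz (p.2 + n)).
  move=> pn; rewrite /phi; have [le|le] := leqP (m p) n.
    rewrite -(KS _ (n - m p)%N) subnKC//; congr (K n); rewrite /m in le *; lia.
  rewrite -(KS n (m p - n)%N) subnKC; last exact: ltnW.
  by move: pn; rewrite /quadrant /m in le * => pn; congr (K _); lia.
have lim : limit_of_charts phi.
  move=> n; have [A [f [AA cA ty e0 en]]] := flat_rect Htau (Kf n) (n + n) (n
    + n).
  have hull := flat_hull Htau (Kf n) AA cA ty e0 en.
  exists A, (fun p => f (p.1 + n%:Z, p.2 + n%:Z)); split=> //.
    exact: chart_translate.
  move=> p pn; rewrite (phiE n); last by move: pn; rewrite /in_box /quadrant;
    lia.
  rewrite -hull; first 1 last.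
  - by move: pn; rewrite /in_box; lia.
  - by move: pn; rewrite /in_box; lia.
  by move: pn; rewrite /in_box /= => pn; congr f; congr pair; lia.
have phik i j : phi (i%:Z, j%:Z) = k i j.
  rewrite (phiE 0%N); last by rewrite /quadrant /=; lia.
  by rewrite -[K 0%N]/k; congr k; rewrite /=; lia.
have [A AA cA] := limit_chart lim.
exists A, phi; split=> //.
have [//|ty] := chart_typed Htau AA cA; exfalso.
have := typed_diff (0, 0) (0, 1) ty; rewrite /=.
rewrite (phik 1%N 0%N) (phik 0%N 0%N) (flat_type kf 1 0) => /addrI.
by move/(congr1 val).
Qed.

(** * Sectors and boundary points *)

Definition cone_chambers (B : A2_building) (k : nat -> nat -> B) :
    set (set B) :=
  [set c | exists i j, c = [set k i j; k i.+1 j; k i j.+1] \/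
                       c = [set k i.+1 j; k i j.+1; k i.+1 j.+1]].

Lemma cone_chambers_tr (B : A2_building) (k : nat -> nat -> B) :
  cone_chambers (fun i j => k j i) = cone_chambers k.
Proof.
have H (l : nat -> nat -> B) c :
    cone_chambers l c -> cone_chambers (fun i j => l j i) c.
  case=> i [j [->|->]]; exists j, i; [left|right].
    by rewrite setUAC.
  by congr (_ `|` _); rewrite setUC.
by apply/seteqP; split=> c /H.
Qed.

Lemma cone_vertex (B : A2_building) (k : nat -> nat -> B) x :
  (\bigcup_(c in cone_chambers k) c) x <-> exists i j, x = k i j.
Proof.
split=> [[_ [i [j [->|->]]] [[|]|] ->]|[i [j ->]]].
- by exists i, j.
- by exists i.+1, j.
- by exists i, j.+1.
- by exists i.+1, j.
- by exists i, j.+1.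
- by exists i.+1, j.+1.
exists [set k i j; k i.+1 j; k i j.+1]; last by left; left.
by exists i, j; left.
Qed.

Lemma plane_sector_image (B : A2_building) (phi : int * int -> B) :
  [set phi @` c | c in plane_sector] =
  cone_chambers (fun i j => phi (i%:Z, j%:Z)).
Proof.
have pS (n : nat) : n.+1%:Z = n%:Z + 1 by lia.
apply/seteqP; split=> [_ [c [[i [j cE]] c0] <-]|s [i [j sE]]].
  have [i0 j0] : 0 <= i /\ 0 <= j.
    case: cE c0 => -> c0.
      by apply: (c0 (i, j)); left; left.
    have [i0 _] : 0 <= i /\ 0 <= j + 1 by apply: (c0 (i, j + 1)); left; right.
    by have [_] : 0 <= i + 1 /\ 0 <= j by apply: (c0 (i + 1, j)); left; left.
  exists (absz i), (absz j).
  have [iE jE] : (absz i)%:Z = i /\ (absz j)%:Z = j by lia.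
  have [i1 j1] : (absz i).+1%:Z = i + 1 /\ (absz j).+1%:Z = j + 1 by lia.
  by case: cE => ->; [left|right]; rewrite /= ?i1 ?j1 ?iE ?jE
    /up_triangle /down_triangle !image_setU !image_set1.
case: sE => ->.
  exists (up_triangle i%:Z j%:Z).
    split; first by exists i%:Z, j%:Z; left.
    by move=> [a b] /up_triangleE /=; lia.
  by rewrite /up_triangle !image_setU !image_set1 !pS.
exists (down_triangle i%:Z j%:Z).
  split; first by exists i%:Z, j%:Z; right.
  by move=> [a b] /down_triangleE /=; lia.
by rewrite /down_triangle !image_setU !image_set1 !pS.
Qed.

Lemma flat_shift (B : A2_building) (tau : B -> 'Z_3) k a b : flat tau k ->
  flat tau (fun i j => k (i + a)%N (j + b)%N).
Proof.
case=> ty e1 e2 e3 s1 s2; split=> i j; rewrite ?addSn //.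
rewrite (ty (i + a)%N) (ty (0 + a)%N) -addrA -intrD; congr (_ + _%:~R); lia.
Qed.

Lemma chart_flat (B : A2_building) (tau : B -> 'Z_3) (A : set (set B)) phi :
  apartment A -> chart A phi -> typed tau phi ->
  flat tau (fun i j => phi (i%:Z, j%:Z)).
Proof.
move=> AA cA ty; split=> i j; first exact: ty.
all: rewrite (chart_adjE _ _ AA cA) /plane_adj /plane_dist_le /=; lia.
Qed.

(** Equivalence of sectors in terms of flat maps, by [sector_equivP]. Translations suffice, as types
    forbid exchanging the axes. *)
Definition eventually_eq (B : A2_building) (k l : nat -> nat -> B) :=
  exists a b c d, forall i j, k (i + a)%N (j + b)%N = l (i + c)%N (j + d)%N.

Lemma eventually_eq_sym (B : A2_building) (k l : nat -> nat -> B) :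
  eventually_eq k l -> eventually_eq l k.
Proof. by move=> [a [b [c [d e]]]]; exists c, d, a, b => i j. Qed.

Lemma eventually_eq_trans (B : A2_building) (k l m : nat -> nat -> B) :
  eventually_eq k l -> eventually_eq l m -> eventually_eq k m.
Proof.
move=> [a [b [c [d e]]]] [a' [b' [c' [d' e']]]].
exists (a' + a)%N, (b' + b)%N, (c + c')%N, (d + d')%N => i j.
by rewrite !addnA e (addnAC i) (addnAC j) e'.
Qed.

Lemma eventually_eq_tr (B : A2_building) (k l : nat -> nat -> B) :
  eventually_eq k l -> eventually_eq (fun i j => k j i) (fun i j => l j i).
Proof. by move=> [a [b [c [d e]]]]; exists b, a, d, c. Qed.

Section Cones.
Variables (B : A2_building) (tau : B -> 'Z_3).
Hypothesis Htau : type_map tau.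
Implicit Types (k l : nat -> nat -> B) (A : set (set B)).

(** A chart of the wrong orientation is swapped, which preserves its cone; conversely,
    [flat_apartment] extends a flat map to a chart. *)
Lemma sector_atP v S : sector_at v S <->
  exists k, [/\ flat tau k, k 0 0 = v & S = cone_chambers k].
Proof.
split=> [[A [phi [AA cA <- ->]]]|[k [kf <- ->]]].
  rewrite plane_sector_image.
  have [ty|ty] := chart_typed Htau AA cA.
    by exists (fun i j => phi (i%:Z, j%:Z)); split=> //;
      exact: (chart_flat AA cA ty).
  exists (fun i j => phi (j%:Z, i%:Z)); split=> //.
    exact: (chart_flat AA (chart_swap cA) ty).
  by rewrite [RHS]cone_chambers_tr.
have [A [phi [AA cA _ e]]] := flat_apartment Htau kf.
exists A, phi; split=> //; first exact: (e 0 0).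
rewrite plane_sector_image; congr cone_chambers.
by apply/funext => i; apply/funext => j; rewrite e.
Qed.

Lemma chart_succ A phi p r : apartment A -> chart A phi -> typed tau phi ->
  adj (phi p) (phi r) -> tau (phi r) = tau (phi p) + 1 ->
  [\/ r = (p.1 + 1, p.2), r = (p.1 - 1, p.2 + 1) | r = (p.1, p.2 - 1)].
Proof.
move=> AA cA ty /(chart_adjE _ _ AA cA) pr tE.
have [l lE] := typed_Z3 (k := 1) ty tE.
exact: plane_adj_succ pr lE.
Qed.

Lemma chart_pred A phi p r : apartment A -> chart A phi -> typed tau phi ->
  adj (phi p) (phi r) -> tau (phi p) = tau (phi r) + 1 ->
  [\/ r = (p.1, p.2 + 1), r = (p.1 - 1, p.2) | r = (p.1 + 1, p.2 - 1)].
Proof.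
move=> AA cA ty /(chart_adjE _ _ AA cA) pr tE.
have [l lE] : exists m, r.1 - p.1 - (r.2 - p.2) - (-1) = 3 * m.
  by apply: (typed_Z3 (k := -1) ty); rewrite tE addrK.
exact: plane_adj_pred pr lE.
Qed.

Lemma flat_succ1 k i j : flat tau k -> tau (k i.+1 j) = tau (k i j) + 1.
Proof.
move=> kf; rewrite (flat_type kf i j) (flat_type kf i.+1 j) -addrA.
by rewrite -[1]/(1%:~R) -intrD; congr (_ + _%:~R); lia.
Qed.

Lemma flat_succ2 k i j : flat tau k -> tau (k i j) = tau (k i j.+1) + 1.
Proof.
move=> kf; rewrite (flat_type kf i j) (flat_type kf i j.+1) -addrA.
by rewrite -[1]/(1%:~R) -intrD; congr (_ + _%:~R); lia.
Qed.

Lemma flat_inj k i j i' j' : flat tau k -> k i j = k i' j' ->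
  i = i' /\ j = j'.
Proof.
move=> kf; have [A [phi [_ cA _ e]]] := flat_apartment Htau kf.
by rewrite -!e => /(cA.1) [-> ->].
Qed.

(** Read in coordinates, the inclusion of cones is an affine map between quadrants. Types leave
    three directions for the image of each axis, and only one of them stays in the quadrant. *)
Lemma cone_sub k l : flat tau k -> flat tau l ->
  (forall i j, exists a b, l i j = k a b) ->
  exists a b, forall i j, l i j = k (i + a)%N (j + b)%N.
Proof.
move=> kf lf lk.
have [A [phi [AA cA ty kE]]] := flat_apartment Htau kf.
have /choice[f fE] : forall p : int * int, exists q : int * int,
    phi q = l (absz p.1) (absz p.2) /\ quadrant 0 q.
  move=> p; have [a [b ->]] := lk (absz p.1) (absz p.2).
  by exists (a%:Z, b%:Z); rewrite kE /quadrant /=; split=> //; lia.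
have [A' [psi [AA' cA' _ lE]]] := flat_apartment Htau lf.
have l_psi p : quadrant 0 p -> l (absz p.1) (absz p.2) = psi p.
  by move=> p0; rewrite -lE; congr psi; case: p p0 => a b;
    rewrite /quadrant /= => p0; congr pair; lia.
have f_psi p : quadrant 0 p -> phi (f p) = psi p.
  by move=> p0; rewrite (fE p).1 l_psi.
have f_aff : forall p, quadrant 0 p -> f p =
    ((f (0, 0)).1 + p.1 * ((f (1, 0)).1 - (f (0, 0)).1)
       + p.2 * ((f (0, 1)).1 - (f (0, 0)).1),
     (f (0, 0)).2 + p.1 * ((f (1, 0)).2 - (f (0, 0)).2)
       + p.2 * ((f (0, 1)).2 - (f (0, 0)).2)).
  apply: plane_affine.
    move=> p q p0 q0 pq; apply/(chart_adjE _ _ AA cA); rewrite !f_psi//.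
    exact: (chart_adj AA' cA' pq).
  by move=> p q p0 q0 pq; apply: cA'.1; rewrite -!f_psi// pq.
have [a fa] : exists a : nat, (f (0, 0)).1 = a%:Z.
  by exists (absz (f (0, 0)).1); have := (fE (0, 0)).2; rewrite /quadrant; lia.
have [b fb] : exists b : nat, (f (0, 0)).2 = b%:Z.
  by exists (absz (f (0, 0)).2); have := (fE (0, 0)).2; rewrite /quadrant; lia.
have f1 : f (1, 0) = (a%:Z + 1, b%:Z).
  have h1 : adj (phi (f (0, 0))) (phi (f (1, 0))).
    by rewrite (fE (0, 0)).1 (fE (1, 0)).1; exact: (flat_e1 lf 0 0).
  have h2 : tau (phi (f (1, 0))) = tau (phi (f (0, 0))) + 1.
    by rewrite (fE (0, 0)).1 (fE (1, 0)).1; exact: flat_succ1.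
  (* Starting from [(a, b)], the two other directions leave the quadrant after [a.+1] and [b.+1]
     steps respectively. *)
  have [->|e|e] := chart_succ AA cA ty h1 h2.
  - by rewrite fa fb.
  - exfalso; have := (fE (a.+1%:Z, 0)).2;
    rewrite (f_aff (a.+1%:Z, 0)) // e /= fa fb /quadrant /=; lia.
  - exfalso; have := (fE (b.+1%:Z, 0)).2;
    rewrite (f_aff (b.+1%:Z, 0)) // e /= fa fb /quadrant /=; lia.
have f2 : f (0, 1) = (a%:Z, b%:Z + 1).
  have h1 : adj (phi (f (0, 0))) (phi (f (0, 1))).
    by rewrite (fE (0, 0)).1 (fE (0, 1)).1; exact: (flat_e2 lf 0 0).
  have h2 : tau (phi (f (0, 0))) = tau (phi (f (0, 1))) + 1.
    by rewrite (fE (0, 0)).1 (fE (0, 1)).1; exact: flat_succ2.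
  have [->|e|e] := chart_pred AA cA ty h1 h2.
  - by rewrite fa fb.
  - exfalso; have := (fE (0, a.+1%:Z)).2;
    rewrite (f_aff (0, a.+1%:Z)) // e /= fa fb /quadrant /=; lia.
  - exfalso; have := (fE (0, b.+1%:Z)).2;
    rewrite (f_aff (0, b.+1%:Z)) // e /= fa fb /quadrant /=; lia.
exists a, b => i j; have := (fE (i%:Z, j%:Z)).1; rewrite /= => <-.
rewrite -kE f_aff /quadrant ?f1 ?f2 ?fa ?fb //=.
by congr phi; congr pair; lia.
Qed.

Lemma sector_equivP k l : flat tau k -> flat tau l ->
  sector_equiv (cone_chambers k) (cone_chambers l) <-> eventually_eq k l.
Proof.
move=> kf lf; split=> [[T [v /sector_atP[m [mf _ ->]]] sub]|[a [b [c [d e]]]]].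
  have H n : flat tau n -> cone_chambers m `<=` cone_chambers n ->
      exists a b, forall i j, m i j = n (i + a)%N (j + b)%N.
    move=> nf mn; apply: cone_sub => // i j; apply/cone_vertex.
    exists [set m i j; m i.+1 j; m i j.+1]; last by left; left.
    by apply: mn; exists i, j; left.
  have [a [b ek]] := H k kf (fun c mc => (sub c mc).1).
  have [c [d el]] := H l lf (fun c mc => (sub c mc).2).
  by exists a, b, c, d => i j; rewrite -ek -el.
exists (cone_chambers (fun i j => k (i + a)%N (j + b)%N)).
  exists (k (0 + a)%N (0 + b)%N); apply/sector_atP.
  by exists (fun i j => k (i + a)%N (j + b)%N); split=> //; exact: flat_shift.
move=> r [i [j cE]]; split; [exists (i + a)%N, (j + b)%N|exists (i + c)%N, (j
  + d)%N].
  by case: cE => ->; rewrite -!addSn; [left|right].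
by case: cE => ->; rewrite -!addSn !e; [left|right].
Qed.

(** The change of coordinates fixes the origin and preserves types, so it belongs to the Weyl group
    of order 6, for which the quadrant is a fundamental domain. *)
Lemma flat_index k l m n m' n' : flat tau k -> flat tau l ->
  k 0 0 = l 0 0 -> k m n = l m' n' -> m = m' /\ n = n'.
Proof.
move=> kf lf e0 emn.
have [A [phi [AA cA ty kE]]] := flat_apartment Htau kf.
have [A' [psi [AA' cA' ty' lE]]] := flat_apartment Htau lf.
have A'0 : A' [set phi (0, 0)].
  by rewrite (kE 0 0) e0 -(lE 0 0); exact: (chart_vertex _ cA').
have A'mn : A' [set phi (m%:Z, n%:Z)].
  by rewrite kE emn -lE; exact: (chart_vertex _ cA').
have [phi2 [cA2 ty2 e20 e2mn]] := transport Htau AA cA ty AA' A'0 A'mn.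
have [f [fE f_adj f_aff]] := chart_affine AA' cA2 cA'.
have f0 : f (0, 0) = (0, 0).
  by apply: cA'.1; rewrite fE e20 (kE 0 0) e0 -(lE 0 0).
have fmn : f (m%:Z, n%:Z) = (m'%:Z, n'%:Z).
  by apply: cA'.1; rewrite fE e2mn kE emn -lE.
have adj1 : plane_adj (0, 0) (1, 0) by [].
have adj2 : plane_adj (0, 0) (0, 1) by [].
have adj3 : plane_adj (1, 0) (0, 1) by [].
have u : tau (psi (f (1, 0))) = tau (psi (f (0, 0))) + 1.
  by rewrite !fE (typed_diff (0, 0) (1, 0) ty2).
have v : tau (psi (f (0, 0))) = tau (psi (f (0, 1))) + 1.
  by rewrite !fE (typed_diff (0, 0) (0, 1) ty2) /= -addrA -[1]/(1%:~R) -intrD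
    addr0.
have a1 : adj (psi (f (0, 0))) (psi (f (1, 0))).
  by rewrite !fE; exact: (chart_adj AA' cA2 adj1).
have a2 : adj (psi (f (0, 0))) (psi (f (0, 1))).
  by rewrite !fE; exact: (chart_adj AA' cA2 adj2).
have := f_adj _ _ adj3; move: fmn; rewrite f_aff.
case: (chart_succ AA' cA' ty' a1 u) => ->; rewrite f0.
all: case: (chart_pred AA' cA' ty' a2 v) => ->; rewrite f0.
all: rewrite /plane_adj /plane_dist_le /=; case; lia.
Qed.

(** Uniqueness of the sector of a class at a given base vertex: the two shifts agree by
    [flat_index], so both maps share arbitrarily far corners, and [flat_hull] fills in the
    rectangles. *)
Lemma flat_eq k l : flat tau k -> flat tau l -> k 0 0 = l 0 0 ->
  eventually_eq k l -> forall i j, k i j = l i j.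
Proof.
move=> kf lf e0 [a [b [c [d e]]]] i j.
have [ac bd] : a = c /\ b = d by have := e 0 0; rewrite !add0n;
  exact: flat_index.
subst c d; have [A [phi [AA cA ty kE]]] := flat_apartment Htau kf.
have h0 : phi (0, 0) = l 0 0 by rewrite (kE 0 0).
have h1 : phi ((i + a)%N%:Z, (j + b)%N%:Z) = l (i + a)%N (j + b)%N
  by rewrite kE e.
by rewrite -kE (flat_hull Htau lf AA cA ty h0 h1)// leq_addr.
Qed.

End Cones.

Lemma flat_move_pred (B : A2_building) (tau : B -> 'Z_3) k x :
  type_map tau -> flat tau k -> adj x (k 0 0) -> tau (k 0 0) = tau x + 1 ->
  exists l, [/\ flat tau l, l 0 0 = x & eventually_eq k l].
Proof.
move=> Htau kf xk tx.
have [x1|x1] := pselect (adj x (k 1 0)); last first.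
  have [l [lf l0 lE]] := flat_ext Htau kf xk tx x1.
  exists l; split=> //; exists 0%N, 0%N, 1%N, 0%N => i j.
  by rewrite addn1 !addn0 lE.
(* If [x] is not opposite to [k 1 0], it either already lies in the cone or starts a new row in
   front of the subcone based at [k 1 0]. *)
have [xE|xE] := pselect (x = k 0 1).
  exists (fun i j => k (i + 0)%N (j + 1)%N); split=> //;
    first exact: flat_shift.
  by exists 0%N, 1%N, 0%N, 0%N => i j; rewrite !addn0.
have Htau' := type_map_opp Htau.
have kf' := flat_tr (flat_shift 1 0 kf).
have x2 : ~ adj x (k 1 1).
  move=> x2; have e : k 0 0 = k 1 1.
    apply: (@link_uniq _ (k 1 0) x (k 0 1)) => //.
    - exact: adj_sym.
    - exact: (flat_e3 kf).
    - exact/adj_sym/(flat_e1 kf).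
    - exact: (flat_e2 kf).
    - exact/adj_sym/(flat_e2 kf).
    - exact: (flat_e1 kf).
  by have [] := flat_inj Htau kf e.
have t1 : - tau (k 1 0) = - tau x + 1.
  rewrite (flat_succ1 0 0 kf) tx; apply/eqP; rewrite -subr_eq0.
  have -> : - (tau x + 1 + 1) - (- tau x + 1) = - (1 *+ 3) by ring.
  by rewrite Z3_three oppr0.
have [l [lf l0 lE]] := flat_ext Htau' kf' x1 t1 x2.
exists (fun i j => l j i); split=> //; first exact: flat_tr_opp.
exists 1%N, 0%N, 0%N, 1%N => i j.
by rewrite !addn0 !addn1 lE addn0 addn1.
Qed.

Lemma flat_move (B : A2_building) (tau : B -> 'Z_3) k x : type_map tau ->
  flat tau k -> adj x (k 0 0) ->
  exists l, [/\ flat tau l, l 0 0 = x & eventually_eq k l].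
Proof.
move=> Htau kf xk; have [tx|tx] := adj_type1 Htau xk.
  exact: flat_move_pred.
have tx' : - tau (k 0 0) = - tau x + 1 by rewrite tx opprD subrK.
have [l [lf l0 kl]] := flat_move_pred (type_map_opp Htau) (flat_tr kf) xk tx'.
exists (fun i j => l j i); split=> //; first exact: flat_tr_opp.
exact: eventually_eq_tr kl.
Qed.

Lemma building_connected (B : A2_building) (x y : B) : exists n, reach x n y.
Proof.
have [A [phi0 [AA cA0 Ax Ay]]] := apartment_common (@simplex_vertex B x)
  (@simplex_vertex B y).
have [phi [cA <-]] := chart_origin cA0 Ax.
have [[i j] ->] := chart_point cA Ay erefl.
have step p q : plane_adj p q -> (exists n, reach (phi (0, 0)) n (phi p)) ->
    exists n, reach (phi (0, 0)) n (phi q).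
  by move=> pq [n np]; exists n.+1; apply: (reachS np);
    exact: (chart_adj AA cA).
elim: j => [|n IH|n IH].
- elim: i => [|n IH|n IH]; first by exists 0%N; exact: reach0.
    by apply: step IH; rewrite /plane_adj /plane_dist_le /=; lia.
  by apply: step IH; rewrite /plane_adj /plane_dist_le /=; lia.
- by apply: step IH; rewrite /plane_adj /plane_dist_le /=; lia.
- by apply: step IH; rewrite /plane_adj /plane_dist_le /=; lia.
Qed.

(** The base vertex is moved along a path, one edge at a time. *)
Lemma flat_at (B : A2_building) (tau : B -> 'Z_3) k x : type_map tau ->
  flat tau k -> exists l, [/\ flat tau l, l 0 0 = x & eventually_eq k l].
Proof.
move=> Htau kf; have [n] := building_connected (k 0 0) x.
elim=> [|m y z _ [l [lf l0 kl]] yz].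
  by exists k; split=> //; exists 0%N, 0%N, 0%N, 0%N.
have lz : adj z (l 0 0) by rewrite l0; exact: adj_sym.
have [l' [lf' l0' ll']] := flat_move Htau lf lz.
by exists l'; split=> //; exact: eventually_eq_trans kl ll'.
Qed.

(** * Boundary points as classes of flat maps *)

Section Boundary.
Variables (B : A2_building) (tau : B -> 'Z_3) (O : B).
Hypothesis Htau : type_map tau.
Implicit Types (k l : nat -> nat -> B) (w : boundary O) (x z : B).

Let in_class w k := flat tau k /\ sval w (cone_chambers k).

Let classP w : exists2 k, flat tau k &
  forall l, in_class w l <-> flat tau l /\ eventually_eq k l.
Proof.
have [S [v /(sector_atP Htau)[k [kf _ ->]]] wE] := svalP w.
exists k => // l; rewrite /in_class wE; split=> -[lf].
  by case=> _ /(sector_equivP Htau kf lf).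
move=> kl; split=> //; split; last exact/(sector_equivP Htau kf lf).
by exists (l 0 0); apply/(sector_atP Htau); exists l.
Qed.

Let class_at w x : exists l, in_class w l /\ l 0 0 = x.
Proof.
have [k kf wE] := classP w; have [l [lf l0 kl]] := flat_at x Htau kf.
by exists l; split=> //; apply/wE.
Qed.

Let class_eq w k l : in_class w k -> in_class w l -> eventually_eq k l.
Proof.
have [m mf wE] := classP w => /wE[_ mk] /wE[_ ml].
exact: eventually_eq_trans (eventually_eq_sym mk) ml.
Qed.

Let class_sub w k l : in_class w k -> flat tau l -> eventually_eq k l ->
  in_class w l.
Proof.
have [m mf wE] := classP w => /wE[_ mk] lf kl; apply/wE; split=> //.
exact: eventually_eq_trans kl.
Qed.

Let basic_at w x z : (exists S, [/\ sval w S, sector_at x S &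
    (\bigcup_(c in S) c) z]) <->
  exists l, [/\ in_class w l, l 0 0 = x & exists i j, z = l i j].
Proof.
split=> [[S [wS /(sector_atP Htau)[l [lf l0 SE]] zS]]|[l [[lf wl] l0 zl]]].
  rewrite SE in wS zS; exists l; split=> //; exact/cone_vertex.
exists (cone_chambers l); split=> //; last exact/cone_vertex.
by apply/(sector_atP Htau); exists l.
Qed.

Definition succ_nbr x z := adj x z /\ tau z = tau x + 1.

Let succ_nbr_flat l i j : flat tau l -> succ_nbr (l 0 0) (l i j) ->
  i = 1%N /\ j = 0%N.
Proof.
move=> lf; have [A [phi [AA cA ty kE]]] := flat_apartment Htau lf.
rewrite /succ_nbr -(kE 0 0) -kE => -[a t].
by case: (chart_succ AA cA ty a t) => -[]; lia.
Qed.

Lemma boundary_basic_ex w : exists z, succ_nbr O z /\ boundary_basic z w.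
Proof.
have [l [[lf wl] l0]] := class_at w O; exists (l 1 0); split.
  by rewrite -l0; split; [exact: (flat_e1 lf)|exact: (flat_succ1 0 0 lf)].
by apply/basic_at; exists l; split=> //; exists 1%N, 0%N.
Qed.

Lemma boundary_basic_uniq w z z' : succ_nbr O z -> succ_nbr O z' ->
  boundary_basic z w -> boundary_basic z' w -> z = z'.
Proof.
move=> zn zn' /basic_at[l [lw l0 [i [j zE]]]] /basic_at[l' [lw' l0' [i' [j'
  zE']]]].
have [lf _] := lw; have [lf' _] := lw'.
rewrite -l0 zE in zn; rewrite -l0' zE' in zn'.
have [i1 j0] := succ_nbr_flat lf zn; have [i1' j0'] := succ_nbr_flat lf' zn'.
rewrite zE zE' i1 j0 i1' j0'; apply: (flat_eq Htau) => //.
  by rewrite l0 l0'.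
exact: class_eq lw lw'.
Qed.

(* [O] lies in the sector based at [x] exactly when the sector based at [O] starts
   opposite to [x]. *)
Lemma boundary_pred_nbr w x : succ_nbr x O ->
  (exists S, [/\ sval w S, sector_at x S & (\bigcup_(c in S) c) O]) <->
  forall z, succ_nbr O z -> boundary_basic z w -> ~ adj x z.
Proof.
move=> xO; split.
  move=> /basic_at[l [lw l0 [i [j OE]]]] z zn /basic_at[m [mw m0 [i' [j' zE]]]].
  have [lf _] := lw; have [mf _] := mw.
  have [i1 j0] : i = 1%N /\ j = 0%N.
    by apply: (succ_nbr_flat lf); rewrite l0 -OE.
  have [i1' j0'] : i' = 1%N /\ j' = 0%N.
    by apply: (succ_nbr_flat mf); rewrite m0 -zE.
  have lf' := flat_shift 1 0 lf.
  have e : forall a b, m a b = l (a + 1)%N (b + 0)%N.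
    apply: (flat_eq Htau mf lf'); first by rewrite m0 OE i1 j0.
    apply: eventually_eq_trans (class_eq mw lw) _.
    by exists 1%N, 0%N, 0%N, 0%N => a b; rewrite !addn0.
  rewrite -l0 zE i1' j0' e; exact: (flat_s1 lf).
move=> H; have [l [lw l0]] := class_at w O; have [lf _] := lw.
have x1 : ~ adj x (l 1 0).
  apply: H; first by rewrite -l0; split;
    [exact: (flat_e1 lf)|exact: (flat_succ1 0 0 lf)].
  by apply/basic_at; exists l; split=> //; exists 1%N, 0%N.
case: xO => xO tO; rewrite -l0 in xO tO.
have [m [mf m0 mE]] := flat_ext Htau lf xO tO x1.
apply/basic_at; exists m; split=> //; last by exists 1%N, 0%N; rewrite mE.
apply: (class_sub lw mf); exists 0%N, 0%N, 1%N, 0%N => i j.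
by rewrite addn1 !addn0 mE.
Qed.

(** The base vertex moves too. When [a z = O], the right-hand side is the condition of
    [boundary_pred_nbr] for [x = a O]. *)
Lemma boundary_basic_map (a : automorphism B) w z :
  boundary_basic z w <-> exists S, [/\ sval (boundary_map a w) S,
    sector_at (a O) S & (\bigcup_(c in S) c) (a z)].
Proof.
split=> [[S [wS SO [c Sc cz]]]|[_ [[S wS <-] SO [_ [c Sc <-] [y cy yz]]]]].
  exists (aut_chambers a S); split; [by exists S|exact: aut_sector_at|].
  by exists (a @` c); [exists c|exists z].
have [b [ab ba]] := aut_inverse a; exists S; split=> //.
  by have := aut_sector_at b SO; rewrite ab (aut_chambersK ab).
by exists c => //; rewrite -(bij_inj (aut_bij a) yz).
Qed.

End Boundary.

(** * Counting in the link of a vertex *)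

Section FiniteSets.
Local Open Scope card_scope.

Lemma card_pred_II (T : finType) (P : pred T) :
  [set x | P x] #= `I_#|P|.
Proof.
have -> : [set x | P x] = @enum_val T P @` [set: 'I_#|P|].
  apply/seteqP; split=> [x Px|_ [i _ <-]]; last exact: (enum_valP i).
  by exists (enum_rank_in (Px : x \in P) x) => //; rewrite enum_rankK_in.
rewrite (card_eql (inj_card_eq _)); last by move=> i j _ _ /enum_val_inj.
by rewrite card_eq_sym card_II.
Qed.

Lemma finite_set_enum (T : Type) (S : set T) : finite_set S ->
  exists n (e : 'I_n -> T), injective e /\ forall x, S x <-> exists i, x = e i.
Proof.
case/finite_setP => n; rewrite (card_eqr card_II) card_eq_sym.
case/card_bijP => f fb; have /bij_inj f_inj := fb; case: fb => g _ fK.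
exists n, (fun i => set_val (f (to_setT i))); split.
  by move=> i j /val_inj /f_inj /(congr1 val).
move=> x; split=> [Sx|[i ->]]; last exact: set_valP.
exists (val (g (SigSub (mem_set Sx)))).
have -> : to_setT (val (g (SigSub (mem_set Sx)))) = g (SigSub (mem_set Sx)).
  exact: val_inj.
by rewrite fK.
Qed.

End FiniteSets.

Section Incidence.
Variables (T : finType) (inc : rel T) (q : nat).
Hypothesis inc_l : forall l, #|[pred k | inc k l]| = q.+1.
Hypothesis inc_k : forall k, #|[pred l | inc k l]| = q.+1.
Hypothesis inc2 : forall l l', l != l' ->
  #|[pred k | inc k l && inc k l']| = 1%N.

(** Counting the pairs of an [l'] other than [l] and a [k] incident to both gives [(q + 1) q] such
    [l']. As [T] indexes points as well as lines, the total [q ^ 2 + q + 1] is also the number of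
    [k], of which [q + 1] are incident to [l]. *)
Lemma card_nonincident l : #|[pred k | ~~ inc k l]| = (q ^ 2)%N.
Proof.
have H : #|[pred l' | l' != l]| = (q.+1 * q)%N.
  transitivity (\sum_(l' | l' != l) \sum_(k | inc k l && inc k l') 1)%N.
    rewrite -sum1_card; apply: eq_big => // l' ll'.
    by rewrite sum1_card inc2// eq_sym.
  rewrite (exchange_big_dep (fun k => inc k l)) /=; last
    by move=> ? ? _ /andP[].
  transitivity (\sum_(k | inc k l) q)%N; last by rewrite sum_nat_const inc_l.
  apply: eq_bigr => k kl.
  have := inc_k k; rewrite (cardD1 l) inE kl add1n => -[<-].
  by rewrite -sum1_card; apply: eq_bigl => l'; rewrite !inE.
have e1 := cardC (pred1 l); rewrite card1 in e1.
have e2 := cardC [pred k | inc k l]; rewrite inc_l in e2.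
have e3 : #|[predC pred1 l]| = (q.+1 * q)%N by rewrite -H; apply: eq_card.
have -> : #|[pred k | ~~ inc k l]| = #|[predC [pred k | inc k l]]|.
  by apply: eq_card.
by apply: (@addnI q.+1); rewrite e2 -e1 e3 mulSn mulnn addnA.
Qed.

End Incidence.

Section LinkCount.
Local Open Scope card_scope.
Variables (B : A2_building) (tau : B -> 'Z_3) (q : nat) (O : B).
Hypotheses (Htau : type_map tau) (Hq : has_order B q).

Lemma common_nbrs_card (x y : B) : adj x y ->
  [set w | adj x w /\ adj y w] #= `I_q.+1.
Proof.
move=> xy.
have e : edge [set x; y].
  split; first exact: xy.2.
  have -> : [set x; y] = (fun n => if n == 0%N then x else y) @` `I_2.
    apply/seteqP; split=> [_ [->|->]|_ [n _ <-]].
    - by exists 0%N.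
    - by exists 1%N.
    - by case: eqP => _; [left|right].
  apply: inj_card_eq => -[|[|n]] [|[|m]]; rewrite ?inE //=.
    by move=> _ _ /xy.1.
  by move=> _ _ /esym/xy.1.
rewrite -(card_eqr (Hq e)) card_eq_sym.
have -> : edge_chambers [set x; y] =
    (fun w => [set x; y; w]) @` [set w | adj x w /\ adj y w].
  apply/seteqP; split=> [c [[cS cmax] sub]|_ [w [xw yw] <-]]; last first.
    split; first exact: triangle_chamber.
    by move=> u; left.
  have [w [xw yw cw]] := simplex_third cS (sub _ (or_introl erefl))
    (sub _ (or_intror erefl)) xy.
  by exists w => //; apply: cmax => //; exact: adj_simplex3.
apply: inj_card_eq => w w'; rewrite !inE => -[xw yw] [xw' yw'] e'.
have : [set x; y; w'] w by rewrite -e'; right.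
by case=> [[/esym/xw.1|/esym/yw.1]|].
Qed.

Lemma succ_nbr_line x z : succ_nbr tau O z ->
  succ_nbr tau x O /\ adj x z <-> adj O x /\ adj z x.
Proof.
move=> [Oz tz]; split=> [[[xO _] xz]|[Ox zx]]; first by split; exact: adj_sym.
split; last exact: adj_sym.
split; first exact: adj_sym.
by apply: (Z3_succ_third _ tz); apply: (adj_type_sum Htau).
Qed.

Lemma succ_nbr_point x z : succ_nbr tau x O ->
  succ_nbr tau O z /\ adj x z <-> adj O z /\ adj x z.
Proof.
move=> [xO tO]; split=> [[[Oz _] xz]//|[Oz xz]]; split=> //; split=> //.
have := Z3_succ_third (adj_type_sum Htau xO Oz xz) tO => tx.
apply/eqP; rewrite -subr_eq0 tO tx.
have -> : tau z - (tau z + 1 + 1 + 1) = - (1 *+ 3) by ring.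
by rewrite Z3_three oppr0.
Qed.

Lemma succ_nbr_finite : finite_set [set z | succ_nbr tau O z].
Proof.
have [[z0 z0n]|H] := pselect (exists z, succ_nbr tau O z); last first.
  have -> : [set z | succ_nbr tau O z] = set0.
    by apply/seteqP; split=> // z zn; apply: H; exists z.
  exact: finite_set0.
have fin x : adj O x -> finite_set [set w | adj O w /\ adj x w].
  by move=> Ox; apply/finite_setP; exists q.+1; exact: common_nbrs_card.
(* Every other point is on one of the finitely many lines through [z0], and each line has finitely
   many points. *)
apply: (@sub_finite_set _ _ ([set z0] `|`
    \bigcup_(x in [set w | adj O w /\ adj z0 w]) [set w | adj O w /\ adj x w])).
  move=> z zn; have [->|zz0] := pselect (z = z0); first by left.
  have [w [Ow zw z0w]] : exists w, [/\ adj O w, adj z w & adj z0 w].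
    by apply: (link_line Htau) zz0 _;
      [exact: zn.1|exact: z0n.1|rewrite zn.2 z0n.2].
  by right; exists w => //; split; [exact: zn.1|exact: adj_sym].
rewrite finite_setU; split; first exact: finite_set1.
by apply: bigcup_finite; [exact/fin/z0n.1|move=> x [Ox _]; exact: fin].
Qed.

(** The link of [O] is a projective plane with points [p] and lines [l]: [common_nbrs_card] counts
    the elements incident to a given one, while [link_line] and [link_uniq] give the line through
    two points. *)
Lemma link_count n (p l : 'I_n -> B) : injective p -> injective l ->
  (forall z, succ_nbr tau O z <-> exists i, z = p i) ->
  (forall x, succ_nbr tau x O <-> exists i, x = l i) ->
  forall i, #|[pred k | ~~ `[< adj (l k) (p i) >]]| = (q ^ 2)%N.
Proof.
move=> p_inj l_inj pE lE;
  apply: (@card_nonincident _ (fun k i => `[< adj (l k) (p i) >])).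
- move=> i; apply/card_eq_II; rewrite -(card_eql (card_pred_II _)).
  have zi : succ_nbr tau O (p i) by apply/pE; exists i.
  rewrite -(card_eqr (common_nbrs_card zi.1)) card_eq_sym.
  have -> : [set w | adj O w /\ adj (p i) w] =
      l @` [set k | `[< adj (l k) (p i) >]].
    apply/seteqP; split=> [w /(succ_nbr_line _ zi)[/lE[k ->] kp]|_ [k /asboolP
      kp <-]].
      by exists k => //=; apply/asboolP.
    by apply/(succ_nbr_line _ zi); split=> //; apply/lE; exists k.
  by apply: inj_card_eq => ? ? _ _; exact: l_inj.
- move=> k; apply/card_eq_II; rewrite -(card_eql (card_pred_II _)).
  have xk : succ_nbr tau (l k) O by apply/lE; exists k.
  have Ok := adj_sym xk.1.
  rewrite -(card_eqr (common_nbrs_card Ok)) card_eq_sym.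
  have -> : [set w | adj O w /\ adj (l k) w] =
      p @` [set i | `[< adj (l k) (p i) >]].
    apply/seteqP; split=> [w /(succ_nbr_point _ xk)[/pE[i ->] kp]|_ [i /asboolP
      kp <-]].
      by exists i => //=; apply/asboolP.
    by apply/(succ_nbr_point _ xk); split=> //; apply/pE; exists i.
  by apply: inj_card_eq => ? ? _ _; exact: p_inj.
- move=> i j /eqP ij.
  have zi : succ_nbr tau O (p i) by apply/pE; exists i.
  have zj : succ_nbr tau O (p j) by apply/pE; exists j.
  have pij : p i <> p j by move=> /p_inj.
  have tij : tau (p i) = tau (p j) by rewrite zi.2 zj.2.
  have [w [Ow iw jw]] := link_line Htau zi.1 zj.1 pij tij.
  have [/lE[k wk] _] : succ_nbr tau w O /\ adj w (p i) by apply/succ_nbr_line.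
  apply/eqP; rewrite -(card1 k); apply/eqP/eq_card => k'.
  rewrite !inE; apply/andP/eqP => [[/asboolP ki /asboolP kj]|->].
    apply: l_inj; rewrite -wk;
      apply: (link_uniq zi.1 zj.1 _ _ _ _ _ _ pij) => //.
    + by apply: adj_sym; apply: ((lE _).2 _).1; exists k'.
    + exact: adj_sym.
    + exact: adj_sym.
  by rewrite -wk; split; apply/asboolP; exact: adj_sym.
Qed.

End LinkCount.

(** * Classes in K_0 *)

Section ProjectionClasses.
Variables (C : numClosedFieldType) (A : cstarAlgType C).
Implicit Types a b u : A.

Lemma K0_classD (p r : projection A) :
  K0_class (proj_sum p r) = K0_class p + K0_class r.
Proof.
rewrite /K0_class /groth_class; apply/esym; rewrite -[LHS]/(groth_add _ _).
rewrite groth_addE /= addr0; congr (groth_pi (_, _)).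
by rewrite -[LHS]/(mvn_add _ _) mvn_addE.
Qed.

Lemma K0_class_mvn (p r : projection A) :
  mvn_rel p r -> K0_class p = K0_class r.
Proof. by move=> /mvn_piP pr; rewrite /K0_class pr. Qed.

Definition is_projection a := star a = a /\ a * a = a.

Lemma adjmx_scalar a : adjmx (a%:M : 'M[A]_1) = (star a)%:M.
Proof. by apply/matrixP => i j; rewrite !mxE !ord1. Qed.

Lemma scalar_mx1M a b : (a%:M : 'M[A]_1) *m b%:M = (a * b)%:M.
Proof. by rewrite scalar_mxM. Qed.

Lemma scalar_projection_adj a : is_projection a ->
  adjmx a%:M = (a%:M : 'M[A]_1).
Proof. by case=> e _; rewrite adjmx_scalar e. Qed.

Lemma scalar_projection_idem a : is_projection a ->
  a%:M *m a%:M = (a%:M : 'M[A]_1).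
Proof. by case=> _ e; rewrite scalar_mx1M e. Qed.

Definition scalar_projection a (pa : is_projection a) :=
  Projection (scalar_projection_adj pa) (scalar_projection_idem pa).

(* [0] unless [a] is a projection. *)
Definition proj_class a : K0 A :=
  if pselect (is_projection a) is left pa then K0_class (scalar_projection pa)
  else 0.

Lemma proj_classE a (pa : is_projection a) :
  proj_class a = K0_class (scalar_projection pa).
Proof.
rewrite /proj_class; case: pselect => // pa'.
by congr (K0_class (scalar_projection _)); exact: Prop_irrelevance.
Qed.

Lemma star1 : star (1 : A) = 1.
Proof. by rewrite -[LHS]mulr1 -{2}(starK 1) -starM mulr1 starK. Qed.

Lemma proj_class1 : proj_class 1 = K0_class (proj_one A).
Proof.
have p1 : is_projection (1 : A) by split; [exact: star1|rewrite mulr1].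
rewrite (proj_classE p1); apply/K0_class_mvn/mvn_relP; exists 1%:M => /=.
by rewrite proj_one_adj mulmx1.
Qed.

Lemma is_projectionD a b : is_projection a -> is_projection b -> a * b = 0 ->
  is_projection (a + b).
Proof.
move=> [a1 a2] [b1 b2] ab; have ba : b * a = 0.
  by rewrite -b1 -a1 -starM ab star0.
by split; rewrite ?starD ?a1 ?b1 // mulrDl !mulrDr a2 b2 ab ba addr0 add0r.
Qed.

(** The row with entries [a] and [b] is a partial isometry between the diagonal matrix of [a] and
    [b] and the projection [a + b], as the mixed products vanish. *)
Lemma proj_classD a b : is_projection a -> is_projection b -> a * b = 0 ->
  proj_class (a + b) = proj_class a + proj_class b.
Proof.
move=> pa pb ab; have pab := is_projectionD pa pb ab.
rewrite (proj_classE pa) (proj_classE pb) (proj_classE pab) -K0_classD.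
apply/esym/K0_class_mvn/mvn_relP; exists (row_mx a%:M b%:M).
have [[a1 a2] [b1 b2]] := (pa, pb).
have ba : b * a = 0 by rewrite -b1 -a1 -starM ab star0.
rewrite adjmx_row !adjmx_scalar a1 b1; split.
  by rewrite mul_col_row !scalar_mx1M a2 b2 ab ba !raddf0.
by rewrite mul_row_col !scalar_mx1M a2 b2 /= raddfD.
Qed.

Lemma proj_class0 : proj_class 0 = 0.
Proof.
have p0 : is_projection (0 : A) by split; [exact: star0|rewrite mulr0].
by apply: (addrI (proj_class 0)); rewrite -proj_classD ?mulr0// !addr0.
Qed.

Lemma proj_class_conj a u : is_projection a -> star u * u = 1 ->
  proj_class (u * a * star u) = proj_class a.
Proof.
move=> pa uu; have [a1 a2] := pa.
have pb : is_projection (u * a * star u).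
  split; first by rewrite !starM starK a1 mulrA.
  by rewrite !mulrA -(mulrA (u * a)) uu mulr1 -(mulrA u) a2.
rewrite (proj_classE pa) (proj_classE pb); apply/esym/K0_class_mvn/mvn_relP.
(* The partial isometry [u * a] has source projection [a] and range projection [u * a * star u]. *)
exists (u * a)%:M; rewrite adjmx_scalar !scalar_mx1M starM a1; split.
  by rewrite /= !mulrA -(mulrA a) uu mulr1 a2.
by rewrite /= !mulrA -(mulrA u) a2.
Qed.

End ProjectionClasses.

(** * Indicator functions of a finite clopen partition *)

Section ClopenPartition.
Variables (C : numClosedFieldType) (X : topologicalType) (n : nat).
Variables (iota : X -> 'I_n).
Hypothesis iota_open : forall i, open [set x | iota x = i].
Implicit Types h : pred 'I_n.

Lemma piece_continuous h : continuous (fun x => (h (iota x))%:R : C).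
Proof.
move=> x; apply: cvg_near_cst.
have : nbhs x [set y | iota y = iota x] by apply: open_nbhs_nbhs; split.
by apply: filterS => y ->.
Qed.

(** The indicator function of the union of the parts selected by [h]. *)
Definition piece h : continuousType X C := cfun_of (@piece_continuous h).

Lemma pieceE h x : piece h x = (h (iota x))%:R.
Proof. by []. Qed.

Lemma pieceD h1 h2 : (forall i, ~~ (h1 i && h2 i)) ->
  piece (fun i => h1 i || h2 i) = piece h1 + piece h2.
Proof.
move=> d; apply/continuousEP => x.
rewrite -[RHS]/(piece h1 x + piece h2 x) !pieceE.
by move: (d (iota x)); case: (h1 _); case: (h2 _); rewrite // ?addr0 ?add0r.
Qed.

Lemma pieceM h1 h2 : piece h1 * piece h2 = piece (fun i => h1 i && h2 i).
Proof.
apply/continuousEP => x; rewrite -[LHS]/(piece h1 x * piece h2 x) !pieceE.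
by case: (h1 _); case: (h2 _); rewrite ?mulr0 ?mulr1.
Qed.

Lemma piece_conj h : cfun_conj (piece h) = piece h.
Proof.
by apply/continuousEP => x; rewrite -[LHS]/((piece h x)^*) pieceE conjC_nat.
Qed.

Lemma pieceT : piece xpredT = 1.
Proof. exact/continuousEP. Qed.

Lemma piece0 : piece xpred0 = 0.
Proof. exact/continuousEP. Qed.

Variables (A : cstarAlgType C) (pi : continuousType X C -> A).
Hypotheses (pi_lin : linear pi) (pi_mor : monoid_morphism pi)
  (pi_star : forall f, pi (cfun_conj f) = star (pi f)).

Let pi0 : pi 0 = 0.
Proof.
by apply: (addrI (pi 0)); have := pi_lin 1 0 0; rewrite !scale1r !addr0 => <-.
Qed.

Let piD f g : pi (f + g) = pi f + pi g.
Proof. by have := pi_lin 1 f g; rewrite !scale1r. Qed.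

Lemma piece_projection h : is_projection (pi (piece h)).
Proof.
split; first by rewrite -pi_star piece_conj.
by rewrite -pi_mor.2 pieceM; congr pi; congr piece; apply/funext => i;
  case: (h i).
Qed.

Lemma piece_class_sum h :
  proj_class (pi (piece h)) = \sum_(i | h i) proj_class (pi (piece (pred1 i))).
Proof.
(* Restricting [h] to a duplicate-free list allows an induction that splits off one part at a time,
   orthogonal to the remaining ones. *)
suff H (r : seq 'I_n) : uniq r ->
    proj_class (pi (piece (fun i => (i \in r) && h i))) =
    \sum_(i <- r | h i) proj_class (pi (piece (pred1 i))).
  rewrite -H ?index_enum_uniq//; congr (proj_class (pi (piece _))).
  by apply/funext => i; rewrite mem_index_enum.
elim: r => [_|j r IH /= /andP[jr ur]].
  rewrite big_nil -[RHS](proj_class0 A) -pi0 -piece0.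
  by congr (proj_class (pi (piece _))); apply/funext.
rewrite big_cons -IH//; case: ifP => hj; last first.
  congr (proj_class (pi (piece _))); apply/funext => i; rewrite inE.
  by case: eqP => [->|]//; rewrite hj !andbF.
rewrite -proj_classD; try exact: piece_projection; last first.
  rewrite -pi_mor.2 pieceM -[RHS]pi0 -piece0; congr (pi (piece _)).
  by apply/funext => i /=; case: eqP => [->|]//; rewrite (negbTE jr).
rewrite -piD -pieceD; last first.
  by move=> i /=; case: eqP => [->|]//; rewrite (negbTE jr).
congr (proj_class (pi (piece _))); apply/funext => i /=; rewrite inE.
by case: eqP => [->|]//; rewrite hj.
Qed.

End ClopenPartition.

(** * Free transitive type rotating actions *)

Section GroupAction.
Variables (B : A2_building) (tau : B -> 'Z_3) (G : groupType).
Variable act : G -> automorphism B.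
Hypothesis actP : A2_group tau act.

Lemma act_inj g h v : act g v = act h v -> g = h.
Proof.
move=> e; have := act_free actP (g := (g^-1 * h)%g) (v := v).
rewrite (act_mul actP) -e -(act_mul actP) mulVg (act_one actP) => /(_ erefl) e'.
by rewrite -[h](mulVKg g) e' mulg1.
Qed.

Lemma act_adj g x y : adj x y -> adj (act g x) (act g y).
Proof.
move=> [xy xyS]; split; first by move=> /(bij_inj (aut_bij (act g))).
by have /aut_simplex := xyS; move=> /(_ (act g));
  rewrite image_setU !image_set1.
Qed.

Lemma act_succ_nbr g x z : succ_nbr tau x z ->
  succ_nbr tau (act g x) (act g z).
Proof.
move=> [xz t]; split; first exact: act_adj.
by have [c cE] := act_rotating actP g; rewrite !cE t addrAC.
Qed.

(** If [x = h O] precedes [O], the inverse of [h] maps the edge from [x] to [O] to one from [O] to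
    some [p i]; as [h] sends this [p i] to [O], freeness gives [h = g i]. *)
Lemma act_nbr_bij (O : B) n (p : 'I_n -> B) : injective p ->
  (forall z, succ_nbr tau O z <-> exists i, z = p i) ->
  exists g : 'I_n -> G, [/\ forall i, act (g i) (p i) = O,
    injective (fun i => act (g i) O) &
    forall x, succ_nbr tau x O <-> exists i, x = act (g i) O].
Proof.
move=> p_inj pE.
have /choice[g gE] : forall i, exists g, act g (p i) = O.
  by move=> i; exact: act_transitive actP _ _.
exists g; split=> //.
  move=> i j /act_inj e; apply: p_inj; apply: (bij_inj (aut_bij (act (g i)))).
  by rewrite gE e gE.
move=> x; split=> [xO|[i ->]].
  have [h hE] := act_transitive actP O x.
  have zE : act h (act h^-1%g O) = O.
    by rewrite -(act_mul actP) mulgV (act_one actP).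
  have xE : act h^-1%g x = O
    by rewrite -hE -(act_mul actP) mulVg (act_one actP).
  have /pE[i iE] : succ_nbr tau O (act h^-1%g O).
    by rewrite -{1}xE; exact: act_succ_nbr.
  exists i; rewrite -hE; congr (act _ O).
  by apply: (@act_inj _ _ (p i)); rewrite gE -iE.
by rewrite -{2}(gE i); apply/act_succ_nbr/pE; exists i.
Qed.

End GroupAction.

(** * The class of the identity in the crossed product *)

Lemma boundary_basic_open (B : A2_building) (O v : B) :
  open (boundary_basic v : set (boundary O)).
Proof.
exists [set boundary_basic v]; last by rewrite bigcup_set1.
by move=> _ ->; apply: (@finI_from1 _ _ _ id); exists v.
Qed.

Theorem proposition8p2 (R : realType) (B : A2_building) (q : nat)
    (tau : B -> 'Z_3) (G : groupType) (act : G -> automorphism B) (O : B)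
    (A : crossed_product R[i]%C
           (fun g => @boundary_map B O (act g))) :
  has_order B q -> type_map tau -> A2_group tau act ->
  K0_class (proj_one A) *+ (q ^ 2 - 1)%N = 0.
Proof.
move=> Hq Htau actP.
have [n [p [p_inj pE]]] := finite_set_enum (succ_nbr_finite O Htau Hq).
have [g [gE l_inj lE]] := act_nbr_bij actP p_inj pE.
pose opp k i := ~~ `[< adj (act (g k) O) (p i) >].
have opp_count := link_count Htau Hq p_inj l_inj pE lE.
have /choice[iota iotaE] : forall w : boundary O,
    exists i, boundary_basic (p i) w.
  move=> w; have [z [/pE[i ->] zw]] := boundary_basic_ex Htau w.
  by exists i.
have p_succ i : succ_nbr tau O (p i) by apply/pE; exists i.
have iotaP w i : iota w = i <-> boundary_basic (p i) w.
  split=> [<-|wi] //; apply: p_inj.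
  exact: (boundary_basic_uniq Htau (p_succ _) (p_succ _) (iotaE w) wi).
have iota_open i : open [set w | iota w = i].
  have -> : [set w | iota w = i] = boundary_basic (p i).
    by apply/seteqP; split=> w /iotaP.
  exact: boundary_basic_open.
(* The element [g k] maps part [k] onto the union of the parts whose points are off the line
   [g k O]. *)
have move_piece k w : iota w = k <->
    opp k (iota (boundary_map (act (g k)) w)).
  rewrite iotaP (boundary_basic_map (act (g k))) gE.
  rewrite (boundary_pred_nbr Htau); last by apply/lE; exists k.
  split=> [H|/asboolPn H z /pE[i ->] /iotaP <- //].
  exact/asboolPn/H.
have [pi_lin pi_mor pi_star _ u_unit pi_act] := cp_covariant A.
pose c h := proj_class (cp_fun A (piece R[i]%C iota_open h)).
have c_sum h : c h = \sum_(i | h i) c (pred1 i)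
  by exact: (piece_class_sum iota_open pi_lin pi_mor pi_star).
(* By covariance, conjugation by the unitary of [g k] turns the indicator of part [k] into that of
   its image. *)
have c_opp k : c (pred1 k) = c (opp k).
  have [uu _] := u_unit (g k).
  have proj := piece_projection iota_open pi_mor pi_star.
  rewrite /c -(proj_class_conj (proj _) uu).
  congr proj_class; apply: pi_act => w; rewrite /= !pieceE.
  by congr ((nat_of_bool _)%:R); apply/idP/eqP => /move_piece.
have c_one : K0_class (proj_one A) = \sum_i c (pred1 i).
  rewrite -proj_class1 -pi_mor.1 -(pieceT R[i]%C iota_open).
  by rewrite -[LHS]/(c xpredT) c_sum.
suff e : K0_class (proj_one A) = K0_class (proj_one A) *+ (q ^ 2).
  (* The subtraction is truncated, so [q = 0] needs its own case. *)
  have [->|q0] := posnP q; first by rewrite mulr0n.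
  by rewrite mulrnBr ?expn_gt0 ?q0// mulr1n -e subrr.
rewrite {1}c_one; under eq_bigr do rewrite c_opp c_sum.
(* After the exchange of sums, the class of part [i] is counted once for each of the [q ^ 2] lines
   that miss the point [p i]. *)
rewrite (exchange_big_dep xpredT) //= c_one -sumrMnl.
apply: eq_bigr => i _; rewrite sumr_const; congr (_ *+ _).
by rewrite -(opp_count i); apply: eq_card.
Qed.
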